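(* Let $1\le\lambda<\infty$ and $1\le p\le\infty$. Then a Banach space $X$ has the weak $\lambda$-BAP for $\mathcal P_p$ if and only if $X$ has the local $\lambda$-BAP for $\mathcal P_p$.
   Context: All Banach spaces are over the same field, real or complex. $\mathcal F(X;Y)$ denotes the finite rank bounded operators, $\mathcal F(X)=\mathcal F(X;X)$. $\mathcal P_p$ ($1\le p<\infty$) is the Banach operator ideal of absolutely $p$-summing operators with the $p$-summing norm; $\mathcal P_\infty=\mathcal L$ is the ideal of all bounded operators with the operator norm. For a Banach operator ideal $(\mathcal A,\|\cdot\|_{\mathcal A})$: $X$ has the weak $\lambda$-BAP for $\mathcal A$ if for every Banach space $Y$ and each $T\in\mathcal A(X;Y)$ there is a net $(S_\alpha)$ in $\mathcal F(X)$ such that $S_\alpha\to I_X$ pointwise and $\limsup_\alpha\|TS_\alpha\|_{\mathcal A}\le\lambda\|T\|_{\mathcal A}$. $X$ has the local $\lambda$-BAP for $\mathcal A$ if for every Banach space $Y$ and each $T\in\mathcal A(X;Y)$ there is a net $(T_\alpha)$ in $\mathcal F(X;Y)$ such that $T_\alpha\to T$ pointwise and $\limsup_\alpha\|T_\alpha\|_{\mathcal A}\le\lambda\|T\|_{\mathcal A}$. *)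

(* Defs.v *)
From HB Require Import structures.
From mathcomp Require Import all_boot all_order all_algebra.
From mathcomp Require Import complex.
From mathcomp Require Import all_classical all_reals all_analysis.

Set Implicit Arguments.
Unset Strict Implicit.
Unset Printing Implicit Defensive.

Import Order.TTheory GRing.Theory Num.Theory.
Import numFieldNormedType.Exports.

Local Open Scope classical_set_scope.
Local Open Scope ring_scope.

Variant scalar_kind := RealScalars | ComplexScalars.

Definition scalar_field (R : realType) (k : scalar_kind) : numFieldType :=
  match k with RealScalars => R | ComplexScalars => R[i] end.

Definition scalar_re (R : realType) (k : scalar_kind) : scalar_field R k -> R :=
  match k return scalar_field R k -> R with
  | RealScalars => fun z : R => z
  | ComplexScalars => fun z : R[i] => complex.Re z
  end.

(* In a normed module over K the norm takes its values in K, so for complex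
   scalars `|x| is a complex number with zero imaginary part; rnorm x is the
   corresponding real number. *)
Definition rnorm (R : realType) (k : scalar_kind)
    (V : normedModType (scalar_field R k)) (x : V) : R :=
  scalar_re `|x|.

Section Operators.
Context {R : realType} {k : scalar_kind}.
Local Notation K := (scalar_field R k).

Definition op_norm (X Y : normedModType K) (T : {linear X -> Y}) : \bar R :=
  ereal_sup [set (rnorm (T x))%:E | x in [set x : X | rnorm x <= 1]].

Definition finite_rank (X Y : normedModType K) (T : {linear X -> Y}) : Prop :=
  exists (n : nat) (v : 'I_n -> Y),
    forall x, exists c : 'I_n -> K, T x = \sum_(i < n) c i *: v i.

Definition finite_rank_bounded (X Y : normedModType K)
    (T : {linear X -> Y}) : Prop :=
  continuous T /\ finite_rank T.

Definition dual_ball (X : normedModType K) : set {linear X -> K^o} :=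
  [set f : {linear X -> K^o} | continuous f /\ (op_norm f <= 1)%E].

Definition strong_lp (X : normedModType K) (r : R) (n : nat)
    (x : 'I_n -> X) : R :=
  (\sum_(i < n) rnorm (x i) `^ r) `^ r^-1.

Definition weak_lp (X : normedModType K) (r : R) (n : nat)
    (x : 'I_n -> X) : \bar R :=
  ereal_sup ((fun f : {linear X -> K^o} =>
                (strong_lp r (fun i => f (x i)))%:E) @` @dual_ball X).

Definition summing_const (X Y : normedModType K) (r : R)
    (T : {linear X -> Y}) (C : R) : Prop :=
  0 <= C /\ forall (n : nat) (x : 'I_n -> X),
    ((strong_lp r (fun i => T (x i)))%:E <= C%:E * weak_lp r x)%E.

Definition summing (X Y : normedModType K) (r : R)
    (T : {linear X -> Y}) : Prop :=
  continuous T /\ exists C, summing_const r T C.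

Definition summing_norm (X Y : normedModType K) (r : R)
    (T : {linear X -> Y}) : \bar R :=
  ereal_inf [set C%:E | C in summing_const r T].

End Operators.

(* The data of a Banach operator ideal on which the approximation properties
   depend: the class of operators and its norm. *)
Record operator_class (R : realType) (k : scalar_kind) := OperatorClass {
  in_class : forall X Y : completeNormedModType (scalar_field R k),
    set {linear X -> Y} ;
  class_norm : forall X Y : completeNormedModType (scalar_field R k),
    {linear X -> Y} -> \bar R }.

(* Only meant for 1 <= p; the value at p = -oo is irrelevant. *)
Definition P_class (R : realType) (k : scalar_kind) (p : \bar R) :
    operator_class R k :=
  match p with
  | r%:E => OperatorClass (fun X Y => [set T | summing r T])
                          (fun X Y T => summing_norm r T)
  | _ => OperatorClass (fun X Y => [set T : {linear X -> Y} | continuous T])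
                       (fun X Y T => op_norm T)
  end.

Definition directed (I : Type) (le : I -> I -> Prop) : Prop :=
  [/\ inhabited I,
      forall a, le a a,
      forall a b c, le a b -> le b c -> le a c &
      forall a b, exists c, le a c /\ le b c].

Definition tails (I : Type) (le : I -> I -> Prop) : set_system I :=
  [set B | exists a, forall b, le a b -> B b].

Definition net_limsup (R : realType) (I : Type) (le : I -> I -> Prop)
    (u : I -> \bar R) : \bar R :=
  ereal_inf [set ereal_sup [set u b | b in [set b | le a b]] | a in setT].

Section BAP.
Context {R : realType} {k : scalar_kind}.
Local Notation K := (scalar_field R k).
Variables (A : operator_class R k) (lambda : R) (X : completeNormedModType K).

Definition weak_BAP : Prop :=
  forall (Y : completeNormedModType K) (T : {linear X -> Y}), in_class A T ->
  exists (I : Type) (le : I -> I -> Prop) (S : I -> {linear X -> X}),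
    [/\ directed le,
        forall a, finite_rank_bounded (S a),
        forall x, S a x @[a --> tails le] --> x &
        (net_limsup le (fun a => class_norm A (T \o S a))
           <= lambda%:E * class_norm A T)%E].

Definition local_BAP : Prop :=
  forall (Y : completeNormedModType K) (T : {linear X -> Y}), in_class A T ->
  exists (I : Type) (le : I -> I -> Prop) (S : I -> {linear X -> Y}),
    [/\ directed le,
        forall a, finite_rank_bounded (S a),
        forall x, S a x @[a --> tails le] --> T x &
        (net_limsup le (fun a => class_norm A (S a))
           <= lambda%:E * class_norm A T)%E].

End BAP.

(* Main.v *)
From HB Require Import structures.
Require Import Defs.
From mathcomp Require Import all_boot all_order all_algebra.
From mathcomp Require Import complex.
From mathcomp Require Import all_classical all_reals all_analysis.
From mathcomp Require Import ring lra.

Set Implicit Arguments.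
Unset Strict Implicit.
Unset Printing Implicit Defensive.

Import Order.TTheory GRing.Theory Num.Theory.
Import numFieldNormedType.Exports.

Local Open Scope classical_set_scope.
Local Open Scope ring_scope.

(** The weak property implies the local one by composition: if [S_a] works for
    [T], then [T \o S_a] is the required net.

    For [p = +oo] the converse is as short: the local property of the identity
    of [X] gives a net [S_a] with [limsup |S_a| <= lambda], and
    [|T S_a| <= |T| |S_a|].

    Let [1 <= p < oo] and let [T : X -> Y] be [p]-summing with norm [C].  The
    local property approximates [T] by finite rank operators into [Y], which
    need not have the form [T \o S], and convergence of [T \o S_a] to [T] says
    little about [S_a].  Two devices repair this.

    (1) Let [f_1, ..., f_n] be bounded functionals on [X].  The operator
    [U x = (T x, d f_1(x) x_1, ..., d f_n(x) x_n)], with fixed vectors [x_i] of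
    [X] and a small [d > 0], has summing norm at most [C + e] ([augment]), also
    as an operator into the closure of its range.  The local property for [U]
    gives a finite rank [V = \sum_j g_j (x) w_j] close to [U] at finitely many
    points.  As [U] has dense range, each [w_j] is almost some [U z_j], so [V]
    is almost [U \o S] with [S = \sum_j g_j (x) z_j], even in summing norm
    ([lift_through_dense_range]).  Reading off coordinates, [T \o S] has
    summing norm at most [lambda C + e], and [f_i (S x)] is close to [f_i x]
    ([weak_operator_approx]): the identity is in the closure, for the weak
    operator topology, of the convex set of all [S] of finite rank with
    [T \o S] of summing norm at most [lambda C + e], for every [e > 0].

    (2) For convex sets the weak and the strong operator topology have the same
    closure, by Hahn-Banach.  Here this is done in one stroke with the seminorm
    [q v = inf_S (\sum_i |v_i - S x_i| + theta |T \o S|)] on [X^m]: if the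
    value of [q] at [(x_i)_i] is small, then a suitable [S] exists; otherwise a
    functional dominated by [q] contradicts (1) ([strong_operator_approx]).

    The net for the weak property is then indexed by the finite subsets of [X]
    together with a precision [1 / (n + 1)].

    As scalars may be real or complex, Hahn-Banach is proved for both at once,
    by regarding a [K]-module as a real vector space through [of_real]. *)

(** * Real and complex scalars *)

Section Scalars.
Context {R : realType} {k : scalar_kind}.
Local Notation K := (scalar_field R k).

Definition of_real : R -> K :=
  match k return R -> scalar_field R k with
  | RealScalars => fun t : R => t
  | ComplexScalars => fun t : R => t%:C%C
  end.

Definition modulus (a : K) : R := @rnorm R k K^o a.

Lemma scalar_reD (a b : K) : scalar_re (a + b) = scalar_re a + scalar_re b.
Proof. by case: k a b => [//|] [a1 a2] [b1 b2]. Qed.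

Lemma scalar_re0 : scalar_re (0 : K) = 0.
Proof. by case: k. Qed.

Lemma scalar_re_of_realM (t : R) (a : K) :
  scalar_re (of_real t * a) = t * scalar_re a.
Proof.
rewrite /of_real; case: k a => [//|] [a1 a2] /=.
by rewrite mul0r subr0.
Qed.

Lemma of_realK (t : R) : scalar_re (of_real t) = t.
Proof. by rewrite /of_real; case: k. Qed.

Lemma of_realD (s t : R) : of_real (s + t) = of_real s + of_real t.
Proof. by rewrite /of_real; case: k => //=; rewrite rmorphD. Qed.

Lemma of_realM (s t : R) : of_real (s * t) = of_real s * of_real t.
Proof. by rewrite /of_real; case: k => //=; rewrite rmorphM. Qed.

Lemma of_real0 : of_real 0 = 0.
Proof. by rewrite /of_real; case: k. Qed.

Lemma of_real1 : of_real 1 = 1.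
Proof. by rewrite /of_real; case: k. Qed.

Lemma of_realN (t : R) : of_real (- t) = - of_real t.
Proof. by rewrite /of_real; case: k => //=; rewrite rmorphN. Qed.

Lemma ge0_of_real (a : K) : 0 <= a -> a = of_real (scalar_re a).
Proof.
rewrite /of_real; case: k a => [//|] a /= a0.
by move: (ger0_Im a0); case: a {a0} => a1 a2 /= ->.
Qed.

Lemma le_of_real (s t : R) : (of_real s <= of_real t) = (s <= t).
Proof. by rewrite /of_real; case: k => //=; rewrite lecE /= eqxx. Qed.

Lemma lt_of_real (s t : R) : (of_real s < of_real t) = (s < t).
Proof. by rewrite /of_real; case: k => //=; rewrite ltcE /= eqxx. Qed.

Lemma scalar_re_modulus (a : K) : scalar_re a <= modulus a.
Proof.
rewrite /modulus /rnorm; case: k a => [|] a /=; first exact: ler_norm.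
by have := normc_ge_Re a; rewrite lecE => /andP[_] /=; exact/le_trans/ler_norm.
Qed.

(** A scalar of modulus at most one turns [a] into its modulus; this transfers
    bounds on real parts of functionals to bounds on moduli. *)
Lemma rotation (a : K) : exists b : K,
  modulus b <= 1 /\ scalar_re (b * a) = modulus a.
Proof.
have [->|a0] := eqVneq a 0.
  exists 0; rewrite /modulus /rnorm mul0r normr0 !scalar_re0; split => //.
have na0 : `|a| != 0 by rewrite normr_eq0.
exists (`|a| / a); rewrite /modulus /rnorm; split.
  by rewrite normrM normr_id normfV divff// -of_real1 of_realK.
by rewrite divfK.
Qed.

Section Norm.
Context {V : normedModType K}.
Implicit Types x y : V.

Lemma normE x : `|x| = of_real (rnorm x).
Proof. by rewrite {1}(ge0_of_real (normr_ge0 x)). Qed.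

Lemma rnorm_ge0 x : 0 <= rnorm x.
Proof. by rewrite -le_of_real -normE of_real0. Qed.

Lemma rnorm0 : rnorm (0 : V) = 0.
Proof. by rewrite /rnorm normr0 scalar_re0. Qed.

Lemma rnorm_eq0 x : rnorm x = 0 -> x = 0.
Proof. by move=> x0; apply/normr0_eq0; rewrite normE x0 of_real0. Qed.

Lemma rnormD x y : rnorm (x + y) <= rnorm x + rnorm y.
Proof. by rewrite -le_of_real of_realD -!normE ler_normD. Qed.

Lemma rnormN x : rnorm (- x) = rnorm x.
Proof. by rewrite /rnorm normrN. Qed.

Lemma rnormB x y : rnorm (x - y) = rnorm (y - x).
Proof. by rewrite -rnormN opprB. Qed.

Lemma rnorm_sum (I : finType) (F : I -> V) :
  rnorm (\sum_i F i) <= \sum_i rnorm (F i).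
Proof.
apply: (big_ind2 (fun a b => rnorm a <= b)) => //.
  by rewrite rnorm0.
by move=> a b c d ab cd; apply: (le_trans (rnormD _ _)); rewrite lerD.
Qed.

End Norm.

Lemma rnormZ {V : normedModType K} (a : K) (x : V) :
  rnorm (a *: x) = modulus a * rnorm x.
Proof.
rewrite {1}/rnorm normrZ !normE scalar_re_of_realM of_realK.
by rewrite /modulus /rnorm.
Qed.

Lemma modulusM (a b : K) : modulus (a * b) = modulus a * modulus b.
Proof. exact: (@rnormZ K^o). Qed.

Lemma modulus_of_real (t : R) : 0 <= t -> modulus (of_real t) = t.
Proof.
move=> t0; rewrite /modulus /rnorm ger0_norm ?of_realK//.
by rewrite -of_real0 le_of_real.
Qed.

(** * Boundedness and neighbourhoods in terms of the real norm *)

Section Topology.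
Context {X Y : normedModType K}.

Lemma bounded_linearP (T : {linear X -> Y}) :
  continuous T <-> exists C : R, 0 <= C /\ forall x, rnorm (T x) <= C * rnorm x.
Proof.
split.
  move=> /linear_bounded_continuous/linear_boundedP/pinfty_ex_gt0[M M0 HM].
  have E := ge0_of_real (ltW M0); exists (scalar_re M); split.
    by rewrite -le_of_real of_real0 -E ltW.
  by move=> x; rewrite -le_of_real of_realM -!normE -E.
move=> [C [C0 HC]]; apply/linear_bounded_continuous/bounded_funP => r.
exists (of_real C * r) => x xr; apply: (@le_trans _ _ (of_real C * `|x|)).
  by rewrite !normE -of_realM le_of_real.
by rewrite ler_wpM2l// -of_real0 le_of_real.
Qed.

Lemma nbhs_rnormP (x : X) (A : set X) :
  nbhs x A <-> exists2 e : R, 0 < e & forall y, rnorm (y - x) < e -> A y.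
Proof.
split.
  move=> /nbhs_normP[e /= e0 H].
  have E := ge0_of_real (ltW e0); exists (scalar_re e).
    by rewrite -lt_of_real of_real0 -E.
  move=> y yx; apply: H; rewrite /ball_ /= normE E lt_of_real.
  by rewrite rnormB.
move=> [e e0 H]; apply/nbhs_normP; exists (of_real e) => /=.
  by rewrite -of_real0 lt_of_real.
by move=> y; rewrite /ball_ /= normE lt_of_real rnormB; exact: H.
Qed.

End Topology.
End Scalars.

(** * The Hahn-Banach theorem for seminorms *)

Lemma linear_map_exists (K : numFieldType) (U V : lmodType K) (f : U -> V) :
  linear f -> exists g : {linear U -> V}, forall x, g x = f x.
Proof.
move=> fL; pose m := GRing.isLinear.Build K U V _ f fL.
pose g : {linear U -> V} := HB.pack f m.
by exists g.
Qed.

Lemma zero_map_exists (K : numFieldType) (U V : lmodType K) :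
  exists f : {linear U -> V}, forall x, f x = 0.
Proof.
apply: (@linear_map_exists K U V (fun=> 0)) => a u v.
by rewrite scaler0 addr0.
Qed.

Section HahnBanach.
Context {R : realType} {k : scalar_kind}.
Local Notation K := (scalar_field R k).
Variables (V : lmodType K) (q : V -> R).
Hypothesis qD : forall v w, q (v + w) <= q v + q w.
Hypothesis qZ : forall a v, q (a *: v) <= modulus a * q v.

Let q_ge0 v : 0 <= q v.
Proof.
have q00 : 0 <= q 0 by have := qD 0 0; rewrite addr0; lra.
have := qD v (- v); have := qZ (- 1) v.
by rewrite /modulus rnormN -/(modulus 1) -of_real1 modulus_of_real//
  of_real1 scaleN1r subrr; lra.
Qed.

Let q_of_real t v : 0 <= t -> q (of_real t *: v) = t * q v.
Proof.
move=> t0; apply/eqP; rewrite eq_le; apply/andP; split.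
  by have := qZ (of_real t) v; rewrite modulus_of_real.
have [->|tn0] := eqVneq t 0; first by rewrite mul0r.
have tp : 0 < t by rewrite lt_def tn0.
have := qZ (of_real t^-1) (of_real t *: v).
rewrite modulus_of_real ?invr_ge0// scalerA -of_realM mulVf//.
by rewrite of_real1 scale1r mulrC ler_pdivlMr// mulrC.
Qed.

(** Partial real-linear functionals below [q], as relations: the bound by [q]
    at [0] makes such a relation single-valued. *)
Definition dominated_graph (G : set (V * R)) :=
  (forall t v r w s, G (v, r) -> G (w, s) ->
     G (of_real t *: v + w, t * r + s)) /\
  (forall v r, G (v, r) -> r <= q v).

Lemma dominated_graph0 G p : dominated_graph G -> G p -> G (0, 0).
Proof.
case: p => v r [Glin _] Gp; have := Glin (- 1) _ _ _ _ Gp Gp.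
by rewrite of_realN of_real1 scaleN1r mulN1r !addNr.
Qed.

Lemma dominated_graphZ G t v r : dominated_graph G -> G (v, r) ->
  G (of_real t *: v, t * r).
Proof.
move=> GG Gv; have := GG.1 t _ _ _ _ Gv (dominated_graph0 GG Gv).
by rewrite !addr0.
Qed.

(** The one-step extension: [c] is the value to be given to [v1].  It has to
    lie between all [r - q (v - v1)] and all [q (w + v1) - s], which is possible
    because [r + s <= q (v + w) <= q (v - v1) + q (w + v1)]. *)
Lemma dominated_graph_step G p v1 : dominated_graph G -> G p ->
  exists c, forall t v r, G (v, r) -> r + t * c <= q (v + of_real t *: v1).
Proof.
move=> GG Gp.
pose L := [set s | exists v r, G (v, r) /\ s = r - q (v - v1)].
have Lub w s : G (w, s) -> ubound L (q (w + v1) - s).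
  move=> Gw _ [v [r [Gv ->]]].
  have := GG.2 _ _ (GG.1 1 _ _ _ _ Gv Gw).
  rewrite of_real1 scale1r mul1r => rs.
  have := qD (v - v1) (w + v1).
  by rewrite addrACA [- v1 + _]addrC subrr addr0; lra.
have Ln0 : L !=set0 by exists (p.2 - q (p.1 - v1)), p.1, p.2; case: p Gp.
have Lbnd : has_ubound L.
  by exists (q (p.1 + v1) - p.2); apply: Lub; case: p Gp {Ln0}.
exists (sup L) => t v r Gv.
have [->|] := eqVneq t 0; last first.
  rewrite neq_lt orbC => /orP[t0|t0].
  - have tn0 : t != 0 by rewrite gt_eqF.
    have /(_ _ _ (dominated_graphZ t^-1 GG Gv))/(ge_sup Ln0) := Lub.
    have -> : v + of_real t *: v1 = of_real t *: (of_real t^-1 *: v + v1).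
      by rewrite scalerDr scalerA -of_realM mulfV// of_real1 scale1r.
    rewrite (q_of_real _ (ltW t0)) -(ler_pM2l t0) mulrBr mulrA mulfV// mul1r.
    by lra.
  - have u0 : 0 < - t by lra.
    have un0 : - t != 0 by rewrite gt_eqF.
    have /(ub_le_sup Lbnd) : L ((- t)^-1 * r - q (of_real (- t)^-1 *: v - v1)).
      by exists (of_real (- t)^-1 *: v), ((- t)^-1 * r); split => //;
        exact: dominated_graphZ.
    have -> : v + of_real t *: v1 =
        of_real (- t) *: (of_real (- t)^-1 *: v - v1).
      rewrite scalerBr scalerA -of_realM mulfV// of_real1 scale1r.
      by rewrite of_realN scaleNr opprK.
    rewrite (q_of_real _ (ltW u0)) -(ler_pM2l u0) mulrBr mulrA mulfV// mul1r.
    by lra.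
by rewrite of_real0 scale0r mul0r !addr0; exact: GG.2.
Qed.

Lemma real_hahn_banach v0 : exists u : V -> R,
  [/\ forall t v w, u (of_real t *: v + w) = t * u v + u w,
      forall v, u v <= q v & u v0 = q v0].
Proof.
(* The empty relation is admitted so that the union of the empty chain is too;
   it is not maximal. *)
pose P (G : set (V * R)) := G = set0 \/ (G (v0, q v0) /\ dominated_graph G).
have Pchain F : F `<=` P -> total_on F subset -> P (\bigcup_(G in F) G).
  move=> FP Ftot.
  have [[G [FG [p Gp]]]|F0] := pselect (exists G, F G /\ G !=set0); last first.
    left; apply/seteqP; split => // p [G FG Gp].
    by apply: F0; exists G; split => //; exists p.
  have PG H p' : F H -> H p' -> H (v0, q v0) /\ dominated_graph H.
    by move=> FH Hp; have [H0|//] := FP _ FH; rewrite H0 in Hp.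
  right; split; first by exists G => //; have [] := PG _ _ FG Gp.
  split; last by move=> v r [H FH Hv]; have [_ [_]] := PG _ _ FH Hv; apply.
  move=> t v r w s [H FH Hv] [H' FH' Hw].
  have [HH'|HH'] := Ftot _ _ FH FH'.
    exists H' => //; have [_ [+ _]] := PG _ _ FH' Hw.
    by apply => //; exact: HH'.
  exists H => //; have [_ [+ _]] := PG _ _ FH Hv.
  by apply => //; exact: HH'.
have [A [PA Amax]] := Zorn_bigcup Pchain.
have [Av0 GA] : A (v0, q v0) /\ dominated_graph A.
  case: PA => // A0; exfalso.
  pose B : set (V * R) := [set p | exists t, p = (of_real t *: v0, t * q v0)].
  have Bv0 : B (v0, q v0) by exists 1; rewrite of_real1 scale1r mul1r.
  apply: (Amax B).
    by rewrite A0; split => // /(_ _ Bv0).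
  right; split => //; split.
    move=> t v r w s [t1 [-> ->]] [t2 [-> ->]]; exists (t * t1 + t2).
    by rewrite of_realD of_realM scalerDl scalerA mulrDl mulrA.
  move=> v r [t [-> ->]]; have [t0|t0] := leP 0 t; first by rewrite q_of_real.
  by apply: (le_trans _ (q_ge0 _)); rewrite mulr_le0_ge0// ltW.
have Atotal v1 : exists r, A (v1, r).
  apply: contrapT => nA; have [c Hc] := dominated_graph_step v1 GA Av0.
  pose B : set (V * R) := [set p | exists t v r,
     A (v, r) /\ p = (v + of_real t *: v1, r + t * c)].
  have AB : A `<=` B.
    move=> [v r] Av; exists 0, v, r; split => //.
    by rewrite of_real0 scale0r mul0r !addr0.
  apply: (Amax B).
    split => // BA; apply: nA; exists c; apply: BA; exists 1, 0, 0; split.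
      exact: dominated_graph0 Av0.
    by rewrite of_real1 scale1r mul1r !add0r.
  right; split; first exact: AB.
  split; last by move=> v r [t [w [s [Aw [-> ->]]]]]; exact: Hc.
  move=> t v r w s [t1 [v' [r' [Av' [-> ->]]]]] [t2 [w' [s' [Aw' [-> ->]]]]].
  exists (t * t1 + t2), (of_real t *: v' + w'), (t * r' + s'); split.
    exact: GA.1.
  rewrite scalerDr scalerA addrACA -of_realM -scalerDl -of_realD.
  by congr pair; ring.
have Afun v r s : A (v, r) -> A (v, s) -> r = s.
  have H r' s' : A (v, r') -> A (v, s') -> r' <= s'.
    move=> Ar As; have := GA.2 _ _ (GA.1 (- 1) _ _ _ _ As Ar).
    rewrite of_realN of_real1 scaleN1r addNr.
    by rewrite -(scale0r v) -of_real0 q_of_real// mul0r; lra.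
  by move=> Ar As; apply/eqP; rewrite eq_le !H.
have [u Au] := choice Atotal; exists u; split.
- by move=> t v w; apply: Afun (Au _) _; exact: GA.1.
- by move=> v; exact: GA.2.
- exact: Afun (Au _) _.
Qed.

(** For complex scalars the only possible choice is [u v - i u (i v)]. *)
Lemma real_part_linear (u : V -> R) :
  (forall t v w, u (of_real t *: v + w) = t * u v + u w) ->
  exists f : {linear V -> K^o}, forall v, scalar_re (f v) = u v.
Proof.
move=> uL.
suff [f fL fu] : exists2 f : V -> K^o,
    linear f & forall v, scalar_re (f v) = u v.
  by have [g gf] := linear_map_exists fL; exists g => v; rewrite gf.
have uD v w : u (v + w) = u v + u w.
  by have := uL 1 v w; rewrite of_real1 scale1r mul1r.
move: V u uL uD; rewrite /of_real; case: k => /= W u uL uD.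
  by exists u.
exists (fun v => (u v +i* - u ('i%C *: v))%C) => // a v w.
have u0 : u 0 = 0 by have := uD 0 0; rewrite addr0; lra.
have uZ t v' : u (t%:C%C *: v') = t * u v'.
  by have := uL t v' 0; rewrite u0 !addr0.
have ua v' : u (a *: v') = complex.Re a * u v' + complex.Im a * u ('i%C *: v').
  have {1}-> : a = (complex.Re a)%:C%C + (complex.Im a)%:C%C * 'i%C.
    by rewrite mulrC; exact: complexE.
  by rewrite scalerDl uD -scalerA !uZ.
have uii v' : u ('i%C *: ('i%C *: v')) = - u v'.
  rewrite scalerA -expr2 sqr_i.
  by have := uZ (- 1) v'; rewrite rmorphN rmorph1 mulN1r.
rewrite uD scalerDr uD scalerA (mulrC _ a) -scalerA !ua uii.
move: (u v) (u w) (u ('i%C *: v)) (u ('i%C *: w)) => s t s' t'.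
rewrite [in RHS]/GRing.scale /=; case: a {ua} => a1 a2 /=.
by apply/eqP; rewrite eq_complex /=; apply/andP; split; apply/eqP; ring.
Qed.

Theorem hahn_banach v0 : exists f : {linear V -> K^o},
  (forall v, modulus (f v) <= q v) /\ scalar_re (f v0) = q v0.
Proof.
have [u [uL uq uv0]] := real_hahn_banach v0.
have [f fu] := real_part_linear uL; exists f; rewrite fu; split => // v.
have [b [b1 <-]] := rotation (f v).
have -> : b * f v = f (b *: v) by rewrite linearZ.
rewrite fu (le_trans (uq _))// (le_trans (qZ _ _))//.
by rewrite ler_piMl.
Qed.

End HahnBanach.

(** * Minkowski's inequality and the weak and strong norms of finite families *)

Section Summing.
Context {R : realType} {k : scalar_kind}.
Local Notation K := (scalar_field R k).
Variables (r : R) (r1 : 1 <= r).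

Let r_gt0 : 0 < r. Proof. exact: lt_le_trans r1. Qed.

Lemma strong_lp_ge0 {X : normedModType K} n (x : 'I_n -> X) :
  0 <= strong_lp r x.
Proof. exact: powR_ge0. Qed.

Lemma strong_lp_leP {X : normedModType K} n (x : 'I_n -> X) (C : R) :
  0 <= C -> strong_lp r x <= C <-> \sum_(i < n) rnorm (x i) `^ r <= C `^ r.
Proof.
move=> C0; have s0 : 0 <= \sum_(i < n) rnorm (x i) `^ r.
  by apply: sumr_ge0 => i _; exact: powR_ge0.
have rn0 : r != 0 by rewrite gt_eqF.
split=> H.
  have := @ge0_ler_powR _ r (ltW r_gt0) _ _ _ _ H.
  by rewrite !nnegrE strong_lp_ge0 C0 -powRrM mulVf// powRr1//; exact.
have := @ge0_ler_powR _ r^-1 _ _ _ _ _ H.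
by rewrite invr_ge0 !nnegrE powR_ge0 s0 ltW// -powRrM mulfV// powRr1//; exact.
Qed.

Lemma strong_lp_scale {X Y : normedModType K} n (c : R)
    (x : 'I_n -> X) (y : 'I_n -> Y) : 0 <= c ->
  (forall i, rnorm (x i) <= c * rnorm (y i)) ->
  strong_lp r x <= c * strong_lp r y.
Proof.
move=> c0 xy; apply/strong_lp_leP.
  by rewrite mulr_ge0// strong_lp_ge0.
rewrite powRM ?strong_lp_ge0//.
apply: (@le_trans _ _ (c `^ r * \sum_(i < n) rnorm (y i) `^ r)).
  rewrite mulr_sumr; apply: ler_sum => i _.
  rewrite -powRM ?rnorm_ge0//; apply: (ge0_ler_powR (ltW r_gt0)) => //.
    by rewrite nnegrE rnorm_ge0.
  by rewrite nnegrE mulr_ge0// rnorm_ge0.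
rewrite ler_wpM2l ?powR_ge0//.
by apply/(strong_lp_leP _ (strong_lp_ge0 _)).
Qed.

Lemma powR_segment (a b t : R) : 0 <= a -> 0 <= b -> 0 <= t <= 1 ->
  (t * a + (1 - t) * b) `^ r <= t * a `^ r + (1 - t) * b `^ r.
Proof.
move=> a0 b0 t01.
have := @convex_powR R r r1 (Itv01 (andP t01).1 (andP t01).2) a b.
rewrite /= !inE /= !in_itv /= !andbT => /(_ a0 b0).
by rewrite [X in _ <= X -> _]convRE /=; apply: le_trans.
Qed.

(** Convexity of the power function, applied to
    [(x + y) / (A + B) = t (x / A) + (1 - t) (y / B)] with [t = A / (A + B)]. *)
Lemma minkowski_sum n (x y z : 'I_n -> R) (A B : R) : 0 < A -> 0 < B ->
  (forall i, 0 <= x i) -> (forall i, 0 <= y i) ->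
  (forall i, 0 <= z i <= x i + y i) ->
  \sum_(i < n) x i `^ r <= A `^ r -> \sum_(i < n) y i `^ r <= B `^ r ->
  \sum_(i < n) z i `^ r <= (A + B) `^ r.
Proof.
move=> A0 B0 x0 y0 zxy xA yB.
have AB0 : 0 < A + B by rewrite addr_gt0.
pose t := A / (A + B).
have t01 : 0 <= t <= 1.
  by rewrite /t divr_ge0 ?(ltW A0) ?(ltW AB0)//= ler_pdivrMr// mul1r; lra.
have tB : 1 - t = B / (A + B) by rewrite /t; field; rewrite gt_eqF.
have step i : z i `^ r <= (A + B) `^ r *
    (t * (A^-1 `^ r * x i `^ r) +
     (1 - t) * (B^-1 `^ r * y i `^ r)).
  apply: (@le_trans _ _ ((x i + y i) `^ r)).
    have /andP[z0 zi] := zxy i.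
    by apply: (ge0_ler_powR (ltW r_gt0)); rewrite ?nnegrE ?addr_ge0.
  have -> : x i + y i = (A + B) *
      (t * (A^-1 * x i) + (1 - t) * (B^-1 * y i)).
    by rewrite tB /t; field; rewrite !gt_eqF.
  have x1 : 0 <= A^-1 * x i.
    by rewrite mulr_ge0// invr_ge0 ltW.
  have y1 : 0 <= B^-1 * y i.
    by rewrite mulr_ge0// invr_ge0 ltW.
  have /andP[t0 t1] := t01.
  rewrite powRM ?(ltW AB0)//; last by rewrite addr_ge0// mulr_ge0// subr_ge0.
  rewrite ler_wpM2l ?powR_ge0//.
  apply: (le_trans (powR_segment x1 y1 t01)).
  by rewrite !powRM ?invr_ge0 ?(ltW A0) ?(ltW B0).
apply: (le_trans (ler_sum _ (fun i _ => step i))).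
rewrite -mulr_sumr big_split /= -!mulr_sumr.
rewrite -[leRHS]mulr1 ler_wpM2l ?powR_ge0//.
have inv (a : R) : 0 < a -> a^-1 `^ r * a `^ r = 1.
  by move=> a0; rewrite -powRM ?invr_ge0 ?(ltW a0)// mulVf ?gt_eqF// powR1.
have /andP[t0 t1] := t01.
rewrite [leRHS](_ : 1 = t * (A^-1 `^ r * A `^ r) +
    (1 - t) * (B^-1 `^ r * B `^ r)); last by rewrite !inv//; ring.
by rewrite lerD// ler_wpM2l ?subr_ge0// ler_wpM2l ?powR_ge0.
Qed.

(** The three families may live in different spaces: this is applied with [z]
    the pairs formed from [x] and [y]. *)
Lemma strong_lp_triangle {X Y Z : normedModType K} n
    (x : 'I_n -> X) (y : 'I_n -> Y) (z : 'I_n -> Z) :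
  (forall i, rnorm (z i) <= rnorm (x i) + rnorm (y i)) ->
  strong_lp r z <= strong_lp r x + strong_lp r y.
Proof.
(* Both summands are made positive so that one may divide by them. *)
have slack m (V : normedModType K) (v : 'I_m -> V) (e : R) : 0 < e ->
    0 < strong_lp r v + e /\
    \sum_(i < m) rnorm (v i) `^ r <= (strong_lp r v + e) `^ r.
  move=> e0; have s0 := strong_lp_ge0 v.
  have se0 : 0 < strong_lp r v + e by rewrite ltr_wpDl.
  split => //; apply/(strong_lp_leP _ (ltW se0)).
  by rewrite lerDl ltW.
move=> zxy; apply/ler_addgt0Pr => e e0.
have e2 : 0 < e / 2 by rewrite divr_gt0.
have [A0 xA] := slack _ _ x _ e2; have [B0 yB] := slack _ _ y _ e2.
have -> : strong_lp r x + strong_lp r y + e =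
    (strong_lp r x + e / 2) + (strong_lp r y + e / 2).
  by rewrite addrACA -splitr.
have AB0 := ltW (addr_gt0 A0 B0).
apply/(strong_lp_leP _ AB0).
apply: minkowski_sum A0 B0 _ _ _ xA yB => i; try exact: rnorm_ge0.
by rewrite rnorm_ge0 zxy.
Qed.

Lemma strong_lp_const1 {X : normedModType K} (x : X) :
  strong_lp r (fun _ : 'I_1 => x) = rnorm x.
Proof.
rewrite /strong_lp big_ord1 -powRrM mulfV ?gt_eqF//.
by rewrite powRr1// rnorm_ge0.
Qed.

Lemma op_norm_leP {X Y : normedModType K} (T : {linear X -> Y}) (C : R) :
  0 <= C ->
  (op_norm T <= C%:E)%E <-> forall x, rnorm (T x) <= C * rnorm x.
Proof.
move=> C0; split => [TC x|TC].
  have [x0|x0] := eqVneq (rnorm x) 0.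
    by rewrite (rnorm_eq0 x0) linear0 !rnorm0 mulr0.
  have xp : 0 < rnorm x by rewrite lt_def x0 rnorm_ge0.
  have : ((rnorm (T (of_real (rnorm x)^-1 *: x)))%:E <= C%:E)%E.
    apply: le_trans TC; apply: ereal_sup_ubound.
    exists (of_real (rnorm x)^-1 *: x) => //=.
    by rewrite rnormZ modulus_of_real ?invr_ge0 ?rnorm_ge0// mulVf.
  rewrite lee_fin linearZ /= rnormZ modulus_of_real ?invr_ge0 ?rnorm_ge0//.
  by rewrite mulrC ler_pdivrMr.
apply: ge_ereal_sup => _ [x /= x1 <-]; rewrite lee_fin.
by rewrite (le_trans (TC x))// ler_piMr.
Qed.

Lemma dual_ballP {X : normedModType K} (f : {linear X -> K^o}) :
  dual_ball f <-> forall x, modulus (f x) <= rnorm x.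
Proof.
split => [[_ /(op_norm_leP _ ler01)] H x|H].
  by have := H x; rewrite mul1r.
have H1 x : rnorm (f x) <= 1 * rnorm x by rewrite mul1r; exact: H.
split; last exact/op_norm_leP.
by apply/bounded_linearP; exists 1.
Qed.

(** Stands for [weak_lp r x <= t] without extended reals ([weak_boundP]). *)
Definition weak_bound {X : normedModType K} n (x : 'I_n -> X) (t : R) :=
  forall f : {linear X -> K^o}, (forall y, modulus (f y) <= rnorm y) ->
    strong_lp r (fun i => f (x i)) <= t.

Lemma weak_boundP {X : normedModType K} n (x : 'I_n -> X) (t : R) :
  weak_bound x t <-> (weak_lp r x <= t%:E)%E.
Proof.
split=> [H|H f fb].
  apply: ge_ereal_sup => _ [f /dual_ballP fb <-].
  by rewrite lee_fin; exact: H.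
rewrite -lee_fin; apply: le_trans H; apply: ereal_sup_ubound.
by exists f => //; apply/dual_ballP.
Qed.

(** The strong norm of [x] is a bound, since functionals of norm at most one
    decrease norms. *)
Lemma weak_lp_fin {X : normedModType K} n (x : 'I_n -> X) :
  weak_lp r x \is a fin_num.
Proof.
have ub : weak_bound x (strong_lp r x).
  move=> f fb; rewrite -[leRHS]mul1r; apply: strong_lp_scale => // i.
  by rewrite mul1r; exact: fb.
have [f f0] := @zero_map_exists K X K^o.
rewrite fin_numElt; apply/andP; split.
  apply: (@lt_le_trans _ _ (strong_lp r (fun i => f (x i)))%:E).
    by rewrite ltNyr.
  apply: ereal_sup_ubound; exists f => //; apply/dual_ballP => y.
  by rewrite f0 /modulus rnorm0 rnorm_ge0.
by apply: le_lt_trans (ltry (strong_lp r x)); apply/weak_boundP.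
Qed.

Lemma summing_constP {X Y : normedModType K} (T : {linear X -> Y}) (C : R) :
  summing_const r T C <-> 0 <= C /\ forall n (x : 'I_n -> X) t,
    weak_bound x t -> strong_lp r (fun i => T (x i)) <= C * t.
Proof.
split=> [[C0 H]|[C0 H]]; split => // n x.
  move=> t /weak_boundP xt; rewrite -lee_fin.
  by apply: (le_trans (H n x)); rewrite EFinM; apply: lee_wpmul2l.
rewrite -(fineK (weak_lp_fin x)) -EFinM lee_fin; apply: H.
by apply/weak_boundP; rewrite fineK// weak_lp_fin.
Qed.

End Summing.

(** * Calculus of summing constants *)

Section SummingConst.
Context {R : realType} {k : scalar_kind}.
Local Notation K := (scalar_field R k).
Variables (r : R) (r1 : 1 <= r).

Lemma weak_bound_ge0 {X : normedModType K} n (x : 'I_n -> X) t :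
  weak_bound r x t -> 0 <= t.
Proof.
move=> xt; have [f f0] := @zero_map_exists K X K^o.
apply: le_trans (xt f _); first exact: strong_lp_ge0.
by move=> y; rewrite f0 /modulus rnorm0 rnorm_ge0.
Qed.

Lemma strong_lp_sum {X : normedModType K} n m (y : 'I_m -> 'I_n -> X) :
  strong_lp r (fun i => \sum_(j < m) y j i) <= \sum_(j < m) strong_lp r (y j).
Proof.
elim: m y => [|m IH] y.
  rewrite big_ord0 -(mul0r (strong_lp r (fun _ : 'I_n => 0 : X))).
  by apply: strong_lp_scale => // i; rewrite big_ord0 rnorm0 mul0r.
rewrite big_ord_recr /=.
apply: (@le_trans _ _ (strong_lp r (fun i => \sum_(j < m)
    y (widen_ord (leqnSn m) j) i) + strong_lp r (y ord_max))); last first.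
  by rewrite lerD2r; exact: IH.
by apply: strong_lp_triangle => // i; rewrite big_ord_recr; exact: rnormD.
Qed.

Lemma weak_bound_functional {X : normedModType K} n (x : 'I_n -> X) t c
    (f : {linear X -> K^o}) : 0 < c ->
  (forall y, modulus (f y) <= c * rnorm y) -> weak_bound r x t ->
  strong_lp r (fun i => f (x i)) <= c * t.
Proof.
move=> c0 fc xt.
have [g gf] : exists g : {linear X -> K^o}, forall y, g y = of_real c^-1 * f y.
  apply: (@linear_map_exists K X K^o) => a u v /=.
  rewrite linearD linearZ /= mulrDr; congr (_ + _).
  by rewrite /GRing.scale /= mulrCA.
have ci0 : 0 <= c^-1 by rewrite invr_ge0 ltW.
have gb y : modulus (g y) <= rnorm y.
  rewrite gf modulusM modulus_of_real//.
  by rewrite mulrC ler_pdivrMr// mulrC.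
apply: (@le_trans _ _ (c * strong_lp r (fun i => g (x i)))).
  apply: (strong_lp_scale r1 (ltW c0)) => i.
  change (modulus (f (x i)) <= c * modulus (g (x i))).
  by rewrite gf modulusM modulus_of_real// mulrA mulfV ?gt_eqF// mul1r.
by rewrite (ler_pM2l c0); exact: xt.
Qed.

(** A rank one operator [f (x) v] has summing norm at most [|f| |v|], directly
    from the definition of the weak norm. *)
Lemma summing_const_finite_sum {X Y : normedModType K} (T : {linear X -> Y})
    n c (f : 'I_n -> {linear X -> K^o}) (v : 'I_n -> Y) : 0 < c ->
  (forall j x, modulus (f j x) <= c * rnorm x) ->
  (forall x, T x = \sum_(j < n) f j x *: v j) ->
  summing_const r T (c * \sum_(j < n) rnorm (v j)).
Proof.
move=> c0 fc TE; apply/(summing_constP r1); split.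
  by rewrite mulr_ge0 ?(ltW c0)// sumr_ge0// => i _; exact: rnorm_ge0.
move=> m x t xt.
have -> : (fun i => T (x i)) = (fun i => \sum_(j < n) f j (x i) *: v j).
  by apply/funext => i; rewrite TE.
apply: (le_trans (strong_lp_sum _)).
rewrite mulrAC mulr_sumr; apply: ler_sum => j _.
apply: (@le_trans _ _ (rnorm (v j) * strong_lp r (fun i => f j (x i)))).
  apply: (strong_lp_scale r1); first exact: rnorm_ge0.
  by move=> i; rewrite rnormZ mulrC.
rewrite mulrC ler_wpM2r ?rnorm_ge0//.
by apply: weak_bound_functional => //; exact: fc.
Qed.

Lemma summing_const_triangle {X Y Z W : normedModType K}
    (S : {linear X -> Y}) (T : {linear X -> Z}) (U : {linear X -> W}) C D :
  (forall x, rnorm (U x) <= rnorm (S x) + rnorm (T x)) ->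
  summing_const r S C -> summing_const r T D -> summing_const r U (C + D).
Proof.
move=> UST /(summing_constP r1)[C0 SC] /(summing_constP r1)[D0 TD].
apply/(summing_constP r1); split; first exact: addr_ge0.
move=> n x t xt; rewrite mulrDl.
apply: (@le_trans _ _ (strong_lp r (fun i => S (x i)) +
                       strong_lp r (fun i => T (x i)))).
  exact: strong_lp_triangle.
by rewrite lerD//; [exact: SC|exact: TD].
Qed.

Lemma summing_const_scale {X Y Z : normedModType K}
    (S : {linear X -> Y}) (T : {linear X -> Z}) c C : 0 <= c ->
  (forall x, rnorm (T x) <= c * rnorm (S x)) ->
  summing_const r S C -> summing_const r T (c * C).
Proof.
move=> c0 TS /(summing_constP r1)[C0 SC].
apply/(summing_constP r1); split; first exact: mulr_ge0.
move=> n x t xt; rewrite -mulrA.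
apply: (le_trans (strong_lp_scale r1 c0 (fun i => TS (x i)))).
by rewrite ler_wpM2l//; exact: SC.
Qed.

Lemma summing_const_dominated {X Y Z : normedModType K}
    (S : {linear X -> Y}) (T : {linear X -> Z}) C :
  (forall x, rnorm (T x) <= rnorm (S x)) ->
  summing_const r S C -> summing_const r T C.
Proof.
move=> TS SC; rewrite -[C]mul1r; apply: summing_const_scale SC => // x.
by rewrite mul1r; exact: TS.
Qed.

Lemma summing_const_le {X Y : normedModType K} (T : {linear X -> Y}) C D :
  C <= D -> summing_const r T C -> summing_const r T D.
Proof.
move=> CD /(summing_constP r1)[C0 TC].
apply/(summing_constP r1); split; first exact: le_trans CD.
move=> n x t xt; apply: (le_trans (TC _ _ _ xt)).
by rewrite ler_wpM2r//; exact: weak_bound_ge0 xt.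
Qed.

Lemma summing_const_bound {X Y : normedModType K} (T : {linear X -> Y}) C x :
  summing_const r T C -> rnorm (T x) <= C * rnorm x.
Proof.
move=> /(summing_constP r1)[C0 TC].
rewrite -(strong_lp_const1 r1 (T x)).
apply: (TC 1%N (fun=> x)) => f fb.
by rewrite (strong_lp_const1 r1); exact: fb.
Qed.

Lemma summing_const_closed {X Y : normedModType K} (T : {linear X -> Y}) C :
  0 <= C -> (forall e, 0 < e -> summing_const r T (C + e)) ->
  summing_const r T C.
Proof.
move=> C0 TC; apply/(summing_constP r1); split => // n x t xt.
have := weak_bound_ge0 xt; rewrite le_eqVlt => /orP[/eqP t0|t0].
  have /(summing_constP r1)[_ /(_ _ _ _ xt)] := TC 1 ltr01.
  by rewrite -t0 !mulr0.
apply/ler_addgt0Pr => e e0.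
have /(summing_constP r1)[_ /(_ _ _ _ xt)] := TC (e / t) (divr_gt0 e0 t0).
by rewrite mulrDl divfK ?gt_eqF.
Qed.

Lemma summing_norm_le {X Y : normedModType K} (T : {linear X -> Y}) C :
  summing_const r T C -> (summing_norm r T <= C%:E)%E.
Proof. by move=> TC; apply: ereal_inf_lbound; exists C. Qed.

Lemma summing_norm_lt {X Y : normedModType K} (T : {linear X -> Y}) C :
  (summing_norm r T < C%:E)%E -> summing_const r T C.
Proof.
move=> /ereal_inf_lt[_ [D TD <-]]; rewrite lte_fin => DC.
exact: summing_const_le (ltW DC) TD.
Qed.

(** The inequalities that define a summing constant are closed conditions on
    it, so the infimum is one of them. *)
Lemma summing_norm_attained {X Y : normedModType K} (T : {linear X -> Y}) D :
  summing_const r T D ->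
  exists2 C, summing_const r T C & summing_norm r T = C%:E.
Proof.
move=> TD.
have n0 : (0 <= summing_norm r T)%E.
  by apply: le_ereal_inf_tmp => _ [C [C0 _] <-]; rewrite lee_fin.
have fn : summing_norm r T \is a fin_num.
  rewrite ge0_fin_numE//; exact: le_lt_trans (summing_norm_le TD) (ltry _).
exists (fine (summing_norm r T)); last by rewrite fineK.
apply: summing_const_closed => [|e e0]; first exact: fine_ge0.
by apply: summing_norm_lt; rewrite EFinD fineK// lteDl.
Qed.

End SummingConst.

(** * Finite rank operators *)

Section FiniteRank.
Context {R : realType} {k : scalar_kind}.
Local Notation K := (scalar_field R k).

Lemma norming_functional (Y : normedModType K) (y0 : Y) :
  exists g : {linear Y -> K^o},
    (forall y, modulus (g y) <= rnorm y) /\ scalar_re (g y0) = rnorm y0.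
Proof.
apply: hahn_banach => [v w|a v]; first exact: rnormD.
by rewrite rnormZ.
Qed.

(** The coordinates of a bounded finite rank operator can be chosen to be
    bounded functionals.  Splitting off a functional [g] that does not vanish at
    some [T x0], and projecting onto the kernel of [g] along [T x0], lowers the
    size of a spanning family by one: the relation [P (T x0) = 0] makes one of
    the projected spanning vectors redundant. *)
Lemma finite_rank_functionals (X Y : normedModType K) (T : {linear X -> Y}) :
  finite_rank_bounded T ->
  exists n c (f : 'I_n -> {linear X -> K^o}) (w : 'I_n -> Y),
    [/\ 0 < c, forall j x, modulus (f j x) <= c * rnorm x &
        forall x, T x = \sum_(j < n) f j x *: w j].
Proof.
move=> [/bounded_linearP[C [C0 TC]] [n [v vT]]].
have zero (S : {linear X -> Y}) : (forall x, S x = 0) ->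
  exists n c (f : 'I_n -> {linear X -> K^o}) (w : 'I_n -> Y),
    [/\ 0 < c, forall j x, modulus (f j x) <= c * rnorm x &
        forall x, S x = \sum_(j < n) f j x *: w j].
  move=> S0; have [f _] := @zero_map_exists K X K^o.
  exists 0%N, 1, (fun=> f), (fun=> 0); split => // [[]//|x].
  by rewrite big_ord0 S0.
elim: n v T C C0 TC vT => [|n IH] v T C C0 TC vT.
  by apply: zero => x; have [c ->] := vT x; rewrite big_ord0.
have [T0|/existsNP[x0 Tx0]] := pselect (forall x, T x = 0); first exact: zero.
have [g [g1 gTx0]] := norming_functional (T x0).
have gn0 : g (T x0) != 0.
  apply/eqP => g0; apply: Tx0; apply: rnorm_eq0.
  by rewrite -gTx0 g0 scalar_re0.
pose b := (g (T x0))^-1 : K.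
(* The projection of Y onto the kernel of g along T x0. *)
have [P PE] : exists P : {linear Y -> Y},
    forall y, P y = y - (b * g y) *: T x0.
  apply: (@linear_map_exists K Y Y) => a y z.
  have -> : g (a *: y + z) = a * g y + g z by rewrite linearD linearZ.
  rewrite mulrDr scalerDl scalerBr scalerA opprD addrACA.
  by rewrite [b * (a * _)]mulrCA.
have PT0 : P (T x0) = 0 by rewrite PE mulVf// scale1r subrr.
have bg x : modulus (b * g (T x)) <= modulus b * C * rnorm x.
  rewrite modulusM -mulrA ler_wpM2l ?rnorm_ge0//.
  exact: le_trans (g1 _) (TC x).
have b0 : 0 <= modulus b * C by rewrite mulr_ge0// rnorm_ge0.
have [a Ta] := vT x0.
have [j aj] : exists j, a j != 0.
  apply: contrapT => /forallNP a0; apply: Tx0; rewrite Ta big1// => i _.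
  by have /negP/negPn/eqP -> := a0 i; rewrite scale0r.
have Pv : P (v j) = \sum_(i < n) - (a j)^-1 * a (lift j i) *: P (v (lift j i)).
  have := PT0; rewrite Ta linear_sum (bigD1_ord j)//= linearZ /=.
  move/eqP; rewrite addr_eq0 => /eqP/(congr1 (fun y => (a j)^-1 *: y)).
  rewrite scalerA mulVf// scale1r => ->.
  rewrite scalerN scaler_sumr -sumrN; apply: eq_bigr => i _.
  by rewrite [P _]linearZ /= scalerA mulNr scaleNr.
have PTC x : rnorm ((P \o T) x) <= (C + modulus b * C * rnorm (T x0)) * rnorm x.
  rewrite /= PE (le_trans (rnormD _ _))// rnormN rnormZ mulrDl lerD//.
  by rewrite mulrAC ler_wpM2r// rnorm_ge0.
have PTspan x : exists c : 'I_n -> K,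
    (P \o T) x = \sum_(i < n) c i *: P (v (lift j i)).
  have [c Tc] := vT x.
  exists (fun i => c j * (- (a j)^-1 * a (lift j i)) + c (lift j i)).
  rewrite /= Tc linear_sum (bigD1_ord j)//= linearZ /= Pv scaler_sumr.
  rewrite -big_split /=; apply: eq_bigr => i _.
  by rewrite [P (_ *: _)]linearZ /= scalerDl scalerA.
have [|m [c [f [w [c0 fc PTE]]]]] := IH _ (P \o T) _ _ PTC PTspan.
  by rewrite addr_ge0// mulr_ge0// rnorm_ge0.
have [f0 f0E] : exists f0 : {linear X -> K^o}, forall x, f0 x = b * g (T x).
  apply: (@linear_map_exists K X K^o) => t x y.
  have -> : g (T (t *: x + y)) = t * g (T x) + g (T y).
    by rewrite !linearD !linearZ.
  by rewrite mulrDr [b * (t * _)]mulrCA.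
exists m.+1, (c + modulus b * C),
  (fun i => if unlift ord0 i is Some j then f j else f0),
  (fun i => if unlift ord0 i is Some j then w j else T x0); split.
- by rewrite ltr_pwDl.
- move=> i x; case: unliftP => [i'|] _.
    by rewrite mulrDl (le_trans (fc _ _))// lerDl mulr_ge0// rnorm_ge0.
  by rewrite f0E mulrDl (le_trans (bg _))// lerDr mulr_ge0 ?rnorm_ge0// ltW.
- move=> x; rewrite big_ord_recl unlift_none f0E.
  under eq_bigr do rewrite liftK.
  by rewrite -PTE /= PE addrC subrK.
Qed.

Lemma functionals_finite_rank (X Y : normedModType K) (T : {linear X -> Y})
    n c (f : 'I_n -> {linear X -> K^o}) (w : 'I_n -> Y) :
  0 <= c -> (forall j x, modulus (f j x) <= c * rnorm x) ->
  (forall x, T x = \sum_(j < n) f j x *: w j) -> finite_rank_bounded T.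
Proof.
move=> c0 fc TE; split; last first.
  by exists n, w => x; exists (fun j => f j x).
apply/bounded_linearP; exists (c * \sum_(j < n) rnorm (w j)); split.
  by rewrite mulr_ge0// sumr_ge0// => j _; exact: rnorm_ge0.
move=> x; rewrite TE (le_trans (rnorm_sum _))// mulrAC mulr_sumr.
by apply: ler_sum => j _; rewrite rnormZ ler_wpM2r ?rnorm_ge0.
Qed.

Lemma finite_rank_boundedD (X Y : normedModType K) (S T U : {linear X -> Y}) :
  finite_rank_bounded S -> finite_rank_bounded T ->
  (forall x, U x = S x + T x) -> finite_rank_bounded U.
Proof.
move=> [/bounded_linearP[C [C0 SC]] [m [v vS]]].
move=> [/bounded_linearP[D [D0 TD]] [n [w wT]]] UE; split.
  apply/bounded_linearP; exists (C + D); split; first exact: addr_ge0.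
  by move=> x; rewrite UE mulrDl (le_trans (rnormD _ _))// lerD.
exists (m + n)%N, (fun i => match fintype.split i with
  | inl i => v i | inr i => w i end) => x.
have [c Sc] := vS x; have [d Td] := wT x.
exists (fun i => match fintype.split i with
  | inl i => c i | inr i => d i end).
rewrite UE Sc Td big_split_ord /=; congr (_ + _); apply: eq_bigr => i _.
  by rewrite -[lshift n i]/(unsplit (inl i)) unsplitK.
by rewrite -[rshift m i]/(unsplit (inr i)) unsplitK.
Qed.

Lemma finite_rank_boundedZ (X Y : normedModType K) (S U : {linear X -> Y}) a :
  finite_rank_bounded S -> (forall x, U x = a *: S x) -> finite_rank_bounded U.
Proof.
move=> [/bounded_linearP[C [C0 SC]] [m [v vS]]] UE; split.
  apply/bounded_linearP; exists (modulus a * C); split.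
    by rewrite mulr_ge0// rnorm_ge0.
  by move=> x; rewrite UE rnormZ -mulrA ler_wpM2l// rnorm_ge0.
exists m, v => x; have [c Sc] := vS x; exists (fun i => a * c i).
by rewrite UE Sc scaler_sumr; apply: eq_bigr => i _; rewrite scalerA.
Qed.

Lemma finite_rank_bounded_comp (X Y Z : normedModType K) (S : {linear X -> Y})
    (T : {linear Y -> Z}) : continuous T -> finite_rank_bounded S ->
  finite_rank_bounded (T \o S).
Proof.
move=> /bounded_linearP[D [D0 TD]] [/bounded_linearP[C [C0 SC]] [m [v vS]]].
split.
  apply/bounded_linearP; exists (D * C); split; first exact: mulr_ge0.
  by move=> x; rewrite /= -mulrA (le_trans (TD _))// ler_wpM2l.
exists m, (fun i => T (v i)) => x; have [c Sc] := vS x; exists c.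
by rewrite /= Sc linear_sum; apply: eq_bigr => i _; rewrite linearZ.
Qed.

End FiniteRank.

(** * Products and closed ranges as Banach spaces *)

(* Pointed uniform structures are needed on products before completeness can be
   declared for them. *)
HB.saturate prod.

Lemma prod_cauchy_cvg (K : numFieldType) (U V : completeNormedModType K)
    (F : set_system (U * V)) : ProperFilter F -> cauchy F -> cvg F.
Proof.
move=> FF /cauchyP Fc.
have Fc1 : cvg (fst @ F).
  apply/cauchy_cvgP/cauchyP => e e0; have [[u v] Fuv] := Fc e e0.
  exists u; apply: (@filterS _ F _ _ (fst @^-1` ball u e) _ Fuv).
  by move=> [x y] [].
have Fc2 : cvg (snd @ F).
  apply/cauchy_cvgP/cauchyP => e e0; have [[u v] Fuv] := Fc e e0.
  exists v; apply: (@filterS _ F _ _ (snd @^-1` ball v e) _ Fuv).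
  by move=> [x y] [].
apply/cvg_ex; exists (lim (fst @ F), lim (snd @ F)) => A [[B C] /= [HB HC] BCA].
have FB := Fc1 _ HB; have FC := Fc2 _ HC.
have FBC : F (fst @^-1` B `&` snd @^-1` C) by exact: filterI.
apply: (@filterS _ F _ _ A _ FBC).
by move=> [x y] [/= Bx Cy]; exact: BCA.
Qed.

HB.instance Definition _ (K : numFieldType) (U V : completeNormedModType K) :=
  Uniform_isComplete.Build (U * V)%type (@prod_cauchy_cvg K U V).

Section ClosedRange.
Variables (K : numFieldType) (X : normedModType K).
Variables (Y : completeNormedModType K) (T : {linear X -> Y}).

Definition closed_range : {pred Y} := fun y => `[< closure (range T) y >].

Lemma closed_rangeP y :
  y \in closed_range <-> forall e, 0 < e -> exists x, `|T x - y| < e.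
Proof.
rewrite unfold_in; split => [/asboolP cly e e0|H].
  have [|_ [[x _ <-] /=]] := cly (ball y e); first exact: nbhsx_ballx.
  by rewrite -ball_normE /= distrC => xe; exists x.
apply/asboolP => B /nbhs_ballP[e /= e0 eB]; have [x xe] := H e e0.
by exists (T x); split => //; apply: eB; rewrite -ball_normE /= distrC.
Qed.

Lemma closed_range_submod : submod_closed closed_range.
Proof.
split.
  by apply/closed_rangeP => e e0; exists 0; rewrite linear0 subr0 normr0.
move=> a u v /closed_rangeP clu /closed_rangeP clv.
apply/closed_rangeP => e e0; pose m := `|a| + 1.
have m0 : 0 < m by rewrite ltr_wpDl.
have [|x xu] := clu (e / 2 / m); first by rewrite !divr_gt0.
have [|y yv] := clv (e / 2); first by rewrite divr_gt0.
exists (a *: x + y); rewrite linearP opprD addrACA -scalerBr.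
rewrite (le_lt_trans (ler_normD _ _))// [ltRHS]splitr.
rewrite ler_ltD// normrZ.
have : m * `|T x - u| <= e / 2 by rewrite mulrC -ler_pdivlMr// ltW.
by apply: le_trans; rewrite ler_wpM2r// lerDl.
Qed.

End ClosedRange.

HB.instance Definition _ (K : numFieldType) (X : normedModType K)
    (Y : completeNormedModType K) (T : {linear X -> Y}) :=
  GRing.isSubmodClosed.Build K Y (closed_range T) (closed_range_submod T).

Record closed_range_type (K : numFieldType) (X : normedModType K)
    (Y : completeNormedModType K) (T : {linear X -> Y}) :=
  ClosedRange {
    closed_range_val : Y ;
    _ : closed_range_val \in closed_range T }.

Section ClosedRangeType.
Variables (K : numFieldType) (X : normedModType K).
Variables (Y : completeNormedModType K) (T : {linear X -> Y}).
Local Notation Z := (closed_range_type T).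

HB.instance Definition _ := [isSub for @closed_range_val K X Y T].
HB.instance Definition _ := [Choice of Z by <:].
HB.instance Definition _ := [SubChoice_isSubLmodule of Z by <:].

Let nrm (z : Z) : K := `|val z|.

Let nrmD (x y : Z) : nrm (x + y) <= nrm x + nrm y.
Proof. by rewrite /nrm raddfD ler_normD. Qed.

Let nrmZ (a : K) (x : Z) : nrm (a *: x) = `|a| * nrm x.
Proof. by rewrite /nrm linearZ normrZ. Qed.

Let nrm0_eq0 (x : Z) : nrm x = 0 -> x = 0.
Proof. by move=> /normr0_eq0 x0; apply: val_inj; rewrite x0 raddf0. Qed.

HB.instance Definition _ := Lmodule_isNormed.Build K Z nrmD nrmZ nrm0_eq0.

Lemma closed_range_normE (z : Z) : `|z| = `|val z|.
Proof. by []. Qed.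

Lemma closed_range_cauchy_cvg (F : set_system Z) :
  ProperFilter F -> cauchy F -> cvg F.
Proof.
move=> FF /cauchyP Fc.
have vF : cvg (val @ F).
  apply/cauchy_cvgP/cauchyP => e e0; have [z Fz] := Fc e e0.
  exists (val z).
  apply: (@filterS _ F _ _ (val @^-1` ball (val z) e) _ Fz) => w.
  by rewrite /= -!ball_normE /= closed_range_normE raddfB.
pose y := lim (val @ F).
have near_y e : 0 < e -> F [set z : Z | `|y - val z| < e].
  by move=> e0; have /cvgrPdist_lt/(_ e e0) := vF.
have cly : y \in closed_range T.
  apply/closed_rangeP => e e0; have e2 : 0 < e / 2 by rewrite divr_gt0.
  have [z /= yz] := filter_ex (near_y _ e2).
  have /closed_rangeP/(_ _ e2)[x xz] := valP z; exists x.
  rewrite -(subrKA (val z)) (le_lt_trans (ler_normD _ _))// [ltRHS]splitr.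
  by rewrite ltrD// distrC.
apply/cvg_ex; exists (ClosedRange cly); apply/cvgrPdist_lt => e e0.
apply: (@filterS _ F _ _ _ _ (near_y e e0)) => z /= yz.
by rewrite closed_range_normE raddfB.
Qed.

HB.instance Definition _ :=
  Uniform_isComplete.Build Z closed_range_cauchy_cvg.

End ClosedRangeType.

(** Shrinking the codomain to the closure of the range preserves norms and
    completeness, and approximation from the range becomes possible. *)
Lemma dense_range_factor (K : numFieldType) (X : normedModType K)
    (Y : completeNormedModType K) (T : {linear X -> Y}) :
  exists (Z : completeNormedModType K) (U : {linear X -> Z}),
    (forall x, `|U x| = `|T x|) /\
    forall z e, 0 < e -> exists x, `|U x - z| < e.
Proof.
have TK x : T x \in closed_range T.
  by apply/closed_rangeP => e e0; exists x; rewrite subrr normr0.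
pose Z := closed_range_type T.
have [U UE] : exists U : {linear X -> Z}, forall x, U x = ClosedRange (TK x).
  apply: linear_map_exists => a x y; apply: val_inj.
  by rewrite [RHS]linearP; exact: linearP.
exists Z, U; split => [x|z e e0]; first by rewrite UE.
have /closed_rangeP/(_ _ e0)[x xz] := valP z; exists x.
by rewrite UE closed_range_normE raddfB.
Qed.

(** * Recording finitely many functionals inside a summing operator *)

Section Augmentation.
Context {R : realType} {k : scalar_kind}.
Local Notation K := (scalar_field R k).
Variables (r : R) (r1 : 1 <= r).

Lemma rnorm_pair (U V : normedModType K) (u : U) (v : V) :
  rnorm (u, v) = Num.max (rnorm u) (rnorm v).
Proof.
rewrite {1}/rnorm prod_normE /= !normE /Order.max lt_of_real.
by case: ifP; rewrite of_realK.
Qed.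

Lemma rnorm_dense_range_factor (X : normedModType K)
    (Y : completeNormedModType K) (T : {linear X -> Y}) :
  exists (Z : completeNormedModType K) (U : {linear X -> Z}),
    (forall x, rnorm (U x) = rnorm (T x)) /\
    forall z e, 0 < e -> exists x, rnorm (U x - z) < e.
Proof.
have [Z [U [UT Ud]]] := dense_range_factor T; exists Z, U.
split => [x|z e e0]; first by rewrite /rnorm UT.
have [|x] := Ud z (of_real e); first by rewrite -of_real0 lt_of_real.
by rewrite normE lt_of_real; exists x.
Qed.

(** The second coordinate [x |-> f x *: w] takes its values in [X], so that
    completeness of the scalar field is not called for; the length of [w] is
    chosen so that this rank one operator has summing norm at most [e]. *)
Lemma augment_one (X Y : completeNormedModType K) (T : {linear X -> Y}) C
    (f : {linear X -> K^o}) c e : 0 < c -> 0 < e ->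
  (forall x, modulus (f x) <= c * rnorm x) -> summing_const r T C ->
  exists (Z : completeNormedModType K) (U : {linear X -> Z}) (d : R),
    [/\ 0 < d, forall x, rnorm (T x) <= rnorm (U x),
        forall x, d * modulus (f x) <= rnorm (U x) &
        summing_const r U (C + e)].
Proof.
move=> c0 e0 fc TC.
(* A vector w of prescribed length exists as soon as f does not vanish. *)
have [f0|/existsNP[x0 fx0]] := pselect (forall x, f x = 0).
  exists Y, T, 1; split => // [x|].
    by rewrite f0 mul1r /modulus rnorm0 rnorm_ge0.
  by apply: (summing_const_le r1 _ TC); rewrite lerDl ltW.
have x00 : 0 < rnorm x0.
  rewrite lt_def rnorm_ge0 andbT; apply/eqP => x0E; apply: fx0.
  by rewrite (rnorm_eq0 x0E) linear0.
have cx0 : 0 < c * rnorm x0 by rewrite mulr_gt0.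
pose a := e / (c * rnorm x0); have a0 : 0 < a by rewrite divr_gt0.
have [w wE] : exists w : X, rnorm w = a * rnorm x0.
  by exists (of_real a *: x0); rewrite rnormZ modulus_of_real// ltW.
have [V VE] : exists V : {linear X -> X}, forall x, V x = f x *: w.
  apply: (@linear_map_exists K X X) => b x y.
  have -> : f (b *: x + y) = b * f x + f y by rewrite linearD linearZ.
  by rewrite scalerDl scalerA.
have [U UE] : exists U : {linear X -> (Y * X)%type},
    forall x, U x = (T x, V x).
  apply: (@linear_map_exists K X (Y * X)%type) => b x y.
  by rewrite !linearP.
exists (Y * X)%type, U, (rnorm w); split.
- by rewrite wE mulr_gt0.
- by move=> x; rewrite UE rnorm_pair le_max lexx.
- by move=> x; rewrite UE rnorm_pair le_max VE rnormZ mulrC lexx orbT.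
- have VC : summing_const r V e.
    have -> : e = c * \sum_(j < 1) rnorm w.
      by rewrite big_ord1 wE /a; field; rewrite !gt_eqF.
    apply: (summing_const_finite_sum r1 (f := fun=> f)) => //.
    by move=> x; rewrite big_ord1 VE.
  apply: (summing_const_triangle r1 _ TC VC) => x.
  by rewrite UE rnorm_pair ge_max lerDl lerDr !rnorm_ge0.
Qed.

Lemma augment (X Y : completeNormedModType K) (T : {linear X -> Y}) C n
    (f : 'I_n -> {linear X -> K^o}) c e : 0 < c -> 0 < e ->
  (forall j x, modulus (f j x) <= c * rnorm x) -> summing_const r T C ->
  exists (Z : completeNormedModType K) (U : {linear X -> Z}) (d : R),
    [/\ 0 < d, forall x, rnorm (T x) <= rnorm (U x),
        forall j x, d * modulus (f j x) <= rnorm (U x) &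
        summing_const r U (C + e)].
Proof.
move=> c0 + + TC; elim: n f e => [|n IH] f e e0 fc.
  exists Y, T, 1; split => // [[]//|].
  by apply: (summing_const_le r1 _ TC); rewrite lerDl ltW.
have e2 : 0 < e / 2 by rewrite divr_gt0.
have [Z [U [d [d0 TU fU UC]]]] :=
  IH (fun j => f (widen_ord (leqnSn n) j)) _ e2 (fun j => fc _).
have [Z' [U' [d' [d'0 UU' fU' U'C]]]] :=
  augment_one c0 e2 (fc ord_max) UC.
exists Z', U', (Num.min d d'); split.
- by rewrite lt_min d0.
- by move=> x; exact: le_trans (TU x) (UU' x).
- move=> j x; have [jn|nj] := ltnP j n.
    have -> : j = widen_ord (leqnSn n) (Ordinal jn) by exact: val_inj.
    apply: le_trans (UU' x); apply: le_trans (fU (Ordinal jn) x).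
    by rewrite ler_wpM2r ?rnorm_ge0// ge_min lexx.
  have -> : j = ord_max.
    by apply/val_inj/eqP; rewrite eqn_leq /= -ltnS ltn_ord.
  apply: le_trans (fU' x).
  by rewrite ler_wpM2r ?rnorm_ge0// ge_min lexx orbT.
- by move: U'C; rewrite -addrA -splitr.
Qed.

End Augmentation.

(** * Approximation along nets *)

Section Nets.
Context {R : realType} {k : scalar_kind}.
Local Notation K := (scalar_field R k).

Lemma directed_finite (I : Type) (le : I -> I -> Prop) m (a : 'I_m -> I) :
  directed le -> exists b, forall i, le (a i) b.
Proof.
move=> [[i0] lexx le_trans ledir]; elim: m a => [|m IH] a.
  by exists i0 => -[].
have [b ab] := IH (fun i => a (lift ord0 i)).
have [c [bc ac]] := ledir b (a ord0); exists c => i.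
by case: (unliftP ord0 i) => [j ->|->//]; apply: le_trans (ab j) bc.
Qed.

Lemma net_limsup_lt (I : Type) (le : I -> I -> Prop) (u : I -> \bar R) C :
  (net_limsup le u < C)%E -> exists a, forall b, le a b -> (u b < C)%E.
Proof.
move=> /ereal_inf_lt[_ [a _ <-] uC]; exists a => b ab.
by apply: le_lt_trans uC; apply: ereal_sup_ubound; exists b.
Qed.

Lemma net_limsup_le (I : Type) (le : I -> I -> Prop) (u : I -> \bar R) C a :
  (forall b, le a b -> (u b <= C)%E) -> (net_limsup le u <= C)%E.
Proof.
move=> uC; apply: le_trans (ereal_inf_lbound _) _; first by exists a.
by apply: ge_ereal_sup => _ [b ab <-]; exact: uC.
Qed.

Lemma cvg_netP (Y : normedModType K) (I : Type) (le : I -> I -> Prop)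
    (u : I -> Y) (y : Y) :
  u a @[a --> tails le] --> y <->
  forall e, 0 < e -> exists a, forall b, le a b -> rnorm (u b - y) < e.
Proof.
split => [uy e e0|H A /nbhs_rnormP[e e0 yA]].
  have : nbhs y [set z | rnorm (z - y) < e].
    by apply/nbhs_rnormP; exists e.
  by move=> /uy[a Ha]; exists a.
by have [a Ha] := H e e0; exists a => b ab; apply: yA; exact: Ha.
Qed.

(** Convergence at finitely many points is all that is used of the nets in the
    local property; directedness provides one operator for all of them. *)
Lemma local_BAP_approx r lambda (X Y : completeNormedModType K)
    (T : {linear X -> Y}) C m (x : 'I_m -> X) e : 1 <= r -> 1 <= lambda ->
  local_BAP (P_class k r%:E) lambda X -> summing_const r T C -> 0 < e ->
  exists U : {linear X -> Y},
    [/\ finite_rank_bounded U, summing_const r U (lambda * C + e) &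
        forall i, rnorm (U (x i) - T (x i)) < e].
Proof.
move=> r1 l1 LB TC e0.
have TS : in_class (P_class k r%:E) T.
  split; last by exists C.
  apply/bounded_linearP; exists C; split; first by case: TC.
  by move=> y; exact: (summing_const_bound r1 _ TC).
have [I [le [S [ledir Sfr ST Slim]]]] := LB Y T TS.
have /net_limsup_lt[a0 Ha0] :
    (net_limsup le (fun a => class_norm (P_class k r%:E) (S a)) <
     (lambda * C + e)%:E)%E.
  apply: (le_lt_trans Slim); apply: (@le_lt_trans _ _ (lambda * C)%:E).
    rewrite EFinM lee_wpmul2l ?lee_fin ?(le_trans _ l1)//.
    exact: (summing_norm_le TC).
  by rewrite lte_fin ltrDl.
have [a Ha] : exists a : 'I_m -> I, forall i b, le (a i) b ->
    rnorm (S b (x i) - T (x i)) < e.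
  have /choice[a Ha] : forall i, exists a, forall b, le a b ->
      rnorm (S b (x i) - T (x i)) < e.
    by move=> i; have /cvg_netP/(_ e e0) := ST (x i).
  by exists a.
have [b0 Hb0] := directed_finite a ledir.
have [_ _ le_trans ledir'] := ledir.
have [b [b0b a0b]] := ledir' b0 a0.
exists (S b); split; first exact: Sfr.
  by apply: (summing_norm_lt r1); exact: (Ha0 b a0b).
by move=> i; apply: Ha; exact: le_trans (Hb0 i) b0b.
Qed.

End Nets.

(** * Approximation of the identity in the weak operator topology *)

Section WeakApproximation.
Context {R : realType} {k : scalar_kind}.
Local Notation K := (scalar_field R k).
Variables (r lambda : R) (r1 : 1 <= r) (l1 : 1 <= lambda).
Variable (X : completeNormedModType K).
Hypothesis LB : local_BAP (P_class k r%:E) lambda X.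

(** [S] is obtained from [V = \sum_j f_j (x) w_j] by replacing each [w_j] by
    some [z_j] with [U z_j] near [w_j]; the error [D] is a finite sum of rank
    one operators, so it is small in summing norm and not only pointwise. *)
Lemma lift_through_dense_range (Z : normedModType K) (U V : {linear X -> Z}) e :
  finite_rank_bounded V -> 0 < e ->
  (forall z d, 0 < d -> exists x, rnorm (U x - z) < d) ->
  exists (S : {linear X -> X}) (D : {linear X -> Z}),
    [/\ finite_rank_bounded S, summing_const r D e &
        forall x, U (S x) = V x + D x].
Proof.
move=> Vfr e0 Ud.
have [n [c [f [w [c0 fc VE]]]]] := finite_rank_functionals Vfr.
have d0 : 0 < e / (c * n.+1%:R) by rewrite divr_gt0// mulr_gt0.
have /choice[z zw] := fun j => Ud (w j) _ d0.
have fL j b x y : f j (b *: x + y) = b * f j x + f j y.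
  by rewrite linearD linearZ.
have [S SE] : exists S : {linear X -> X},
    forall x, S x = \sum_(j < n) f j x *: z j.
  apply: (@linear_map_exists K X X) => b x y.
  rewrite scaler_sumr -big_split /=; apply: eq_bigr => j _.
  by rewrite fL scalerDl scalerA.
have [D DE] : exists D : {linear X -> Z},
    forall x, D x = \sum_(j < n) f j x *: (U (z j) - w j).
  apply: (@linear_map_exists K X Z) => b x y.
  rewrite scaler_sumr -big_split /=; apply: eq_bigr => j _.
  by rewrite fL scalerDl scalerA.
exists S, D; split.
- exact: functionals_finite_rank (ltW c0) fc SE.
- apply: (summing_const_le r1 _ (summing_const_finite_sum r1 c0 fc DE)).
  apply: (@le_trans _ _ (c * \sum_(j < n) (e / (c * n.+1%:R)))).
    rewrite (ler_pM2l c0); apply: ler_sum => j _; exact: ltW.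
  rewrite sumr_const card_ord -mulr_natr.
  rewrite (_ : c * _ = e * (n%:R / n.+1%:R)); last first.
    have : (n.+1%:R : R) != 0 by rewrite pnatr_eq0.
    by move: (n.+1%:R : R) => N N0; field; rewrite N0 gt_eqF.
  by rewrite ler_piMr ?(ltW e0)// ler_pdivrMr// mul1r ler_nat.
- move=> x; rewrite SE VE DE linear_sum -big_split /=.
  apply: eq_bigr => j _; rewrite linearZ /=.
  by rewrite -scalerDr addrC subrK.
Qed.

(** [T] and all the functionals [f j] are controlled at once by an augmented
    operator [U]; being near [U] at [x j] then forces [f j (S (x j))] to be near
    [f j (x j)]. *)
Lemma weak_operator_approx (Y : completeNormedModType K) (T : {linear X -> Y})
    C n (f : 'I_n -> {linear X -> K^o}) (x : 'I_n -> X) e :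
  (forall j y, modulus (f j y) <= rnorm y) -> summing_const r T C -> 0 < e ->
  exists S : {linear X -> X},
    [/\ finite_rank_bounded S, summing_const r (T \o S) (lambda * C + e) &
        forall j, modulus (f j (S (x j) - x j)) < e].
Proof.
move=> f1 TC e0; have l0 : 0 < lambda by exact: lt_le_trans l1.
have e4 : 0 < e / 4 by rewrite divr_gt0.
have fc j y : modulus (f j y) <= 1 * rnorm y by rewrite mul1r.
have [Z0 [U0 [d [d0 TU0 fU0 U0C]]]] :=
  augment r1 ltr01 (divr_gt0 e4 l0) fc TC.
have [Z [U [UU0 Ud]]] := rnorm_dense_range_factor U0.
have TU y : rnorm (T y) <= rnorm (U y) by rewrite UU0.
have fU j y : d * modulus (f j y) <= rnorm (U y) by rewrite UU0.
have UC : summing_const r U (C + e / 4 / lambda).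
  by apply: (summing_const_dominated r1 _ U0C) => y; rewrite UU0.
have de2 : 0 < d * e / 2 by rewrite divr_gt0// mulr_gt0.
have e1 : 0 < Num.min (e / 4) (d * e / 2) by rewrite lt_min e4.
have [V [Vfr VC VU]] := local_BAP_approx x r1 l1 LB UC e1.
pose s := 1 + \sum_i rnorm (x i).
have xs i : rnorm (x i) <= s.
  rewrite /s (bigD1 i)//= addrCA lerDl addr_ge0// sumr_ge0// => j _.
  exact: rnorm_ge0.
have s0 : 0 < s by rewrite ltr_wpDr// sumr_ge0// => j _; exact: rnorm_ge0.
have e2 : 0 < Num.min (e / 4) (d * e / 2 / s) by rewrite lt_min e4 divr_gt0.
have [S [D [Sfr DC USE]]] := lift_through_dense_range Vfr e2 Ud.
exists S; split; first exact: Sfr.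
  have TSV y : rnorm ((T \o S) y) <= rnorm (V y) + rnorm (D y).
    by rewrite (le_trans (TU _))// USE rnormD.
  apply: (summing_const_le r1 _ (summing_const_triangle r1 TSV VC DC)).
  have : lambda * (e / 4 / lambda) = e / 4 by rewrite mulrC divfK// gt_eqF.
  have : Num.min (e / 4) (d * e / 2) <= e / 4 by rewrite ge_min lexx.
  have : Num.min (e / 4) (d * e / 2 / s) <= e / 4 by rewrite ge_min lexx.
  rewrite mulrDr; lra.
move=> j; rewrite -(ltr_pM2l d0) (le_lt_trans (fU _ _))//.
rewrite linearB USE addrAC (le_lt_trans (rnormD _ _))//.
rewrite [ltRHS]splitr ltr_leD//.
  by apply: lt_le_trans (VU j) _; rewrite ge_min lexx orbT.
apply: (le_trans (summing_const_bound r1 _ DC)).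
apply: (@le_trans _ _ (d * e / 2 / s * s)); last first.
  by rewrite divfK// gt_eqF.
rewrite ler_pM ?rnorm_ge0 ?(ltW e2)// ge_min lexx orbT//.
Qed.

End WeakApproximation.

(** * From the weak to the strong operator topology *)

Section Separation.
Context {R : realType} {k : scalar_kind}.
Local Notation K := (scalar_field R k).
Variables (r lambda : R) (r1 : 1 <= r) (l1 : 1 <= lambda).
Variable (X : completeNormedModType K).
Hypothesis LB : local_BAP (P_class k r%:E) lambda X.
Variables (Y : completeNormedModType K) (T : {linear X -> Y}).

Section Gauge.
Variables (m : nat) (x : 'I_m -> X) (theta : R).
Hypothesis theta0 : 0 <= theta.
Local Notation V := {ffun 'I_m -> X}.

(** The infimum of this set balances how well [v] is attained by some [S]
    against how costly this [S] is.  It is a seminorm in [v], since the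
    admissible pairs [(S, N)] can be added and scaled; so Hahn-Banach for
    seminorms applies and no convex set has to be separated from a point. *)
Definition gauge_set (v : V) : set R :=
  [set t | exists (S : {linear X -> X}) N,
    [/\ finite_rank_bounded S, summing_const r (T \o S) N &
        \sum_i rnorm (v i - S (x i)) + theta * N <= t]].

Definition gauge (v : V) : R := inf (gauge_set v).

Lemma gauge_set_norm v : gauge_set v (\sum_i rnorm (v i)).
Proof.
have [S S0] := @zero_map_exists K X X.
have [f _] := @zero_map_exists K X K^o.
exists S, 0; split.
- apply: (@functionals_finite_rank _ _ _ _ S 0 0 (fun=> f) (fun=> 0) (lexx 0)).
    by case.
  by move=> y; rewrite big_ord0.
- apply/(summing_constP r1); split => // n y t yt; rewrite mul0r.
  rewrite -(mul0r (strong_lp r y)); apply: (strong_lp_scale r1 (lexx 0)) => i.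
  by rewrite /= S0 linear0 rnorm0 mul0r.
- rewrite mulr0 addr0; apply: ler_sum => i _.
  by rewrite S0 subr0.
Qed.

Lemma gauge_set_ge0 v t : gauge_set v t -> 0 <= t.
Proof.
move=> [S [N [_ [N0 _]]]]; apply: le_trans.
by rewrite addr_ge0 ?mulr_ge0// sumr_ge0// => i _; exact: rnorm_ge0.
Qed.

Lemma gauge_has_inf v : has_inf (gauge_set v).
Proof.
split; first by exists (\sum_i rnorm (v i)); exact: gauge_set_norm.
by exists 0 => t; exact: gauge_set_ge0.
Qed.

Lemma gauge_le v t : gauge_set v t -> gauge v <= t.
Proof. by apply: ge_inf; exists 0 => s; exact: gauge_set_ge0. Qed.

Lemma gauge_lt v t : gauge v < t -> exists2 s, gauge_set v s & s < t.
Proof. by move=> /(inf_lt (gauge_has_inf v).1)[s vs st]; exists s. Qed.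

Lemma gaugeD v w : gauge (v + w) <= gauge v + gauge w.
Proof.
apply/ler_addgt0Pr => e e0; have e2 : 0 < e / 2 by rewrite divr_gt0.
have [|s [S [M [Sfr SM vs]]] sv] := @gauge_lt v (gauge v + e / 2).
  by rewrite ltrDl.
have [|t [S' [N [S'fr S'N wt]]] tw] := @gauge_lt w (gauge w + e / 2).
  by rewrite ltrDl.
apply: (@le_trans _ _ (s + t)); last first.
  by rewrite (splitr e) addrACA lerD// ltW.
apply: gauge_le.
have [U UE] : exists U : {linear X -> X}, forall y, U y = S y + S' y.
  apply: (@linear_map_exists K X X) => a y z.
  by rewrite !linearP scalerDr addrACA.
exists U, (M + N); split.
- exact: finite_rank_boundedD Sfr S'fr UE.
- apply: (summing_const_triangle r1 _ SM S'N) => y /=.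
  by rewrite UE linearD rnormD.
- apply: le_trans (lerD vs wt); rewrite addrACA -mulrDr lerD2r -big_split /=.
  apply: ler_sum => i _; rewrite UE ffunE opprD addrACA; exact: rnormD.
Qed.

Lemma gaugeZ a v : gauge (a *: v) <= modulus a * gauge v.
Proof.
have a0 : 0 <= modulus a by exact: rnorm_ge0.
have step t : gauge_set v t -> gauge (a *: v) <= modulus a * t.
  move=> [S [N [Sfr SN vt]]]; apply: gauge_le.
  have [U UE] : exists U : {linear X -> X}, forall y, U y = a *: S y.
    apply: (@linear_map_exists K X X) => b y z.
    by rewrite linearP scalerDr !scalerA mulrC.
  exists U, (modulus a * N); split.
  - exact: finite_rank_boundedZ Sfr UE.
  - apply: (summing_const_scale r1 a0 _ SN) => y /=.
    by rewrite UE linearZ rnormZ.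
  - apply: le_trans (ler_wpM2l a0 vt); rewrite mulrDr mulrCA lerD2r mulr_sumr.
    by apply: ler_sum => i _; rewrite UE ffunE -scalerBr rnormZ.
apply/ler_addgt0Pr => e e0; have a1 : 0 < modulus a + 1 by rewrite ltr_wpDl.
have [|t vt tv] := @gauge_lt v (gauge v + e / (modulus a + 1)).
  by rewrite ltrDl divr_gt0.
apply: (le_trans (step t vt)).
apply: (@le_trans _ _ (modulus a * (gauge v + e / (modulus a + 1)))).
  by rewrite ler_wpM2l// ltW.
rewrite mulrDr lerD2l mulrCA ler_piMr ?(ltW e0)//.
by rewrite ler_pdivrMr// mul1r lerDl.
Qed.

End Gauge.

(** With [theta = e / M] and [M = lambda C + mu], a value of the seminorm below
    [e] at [(x_i)_i] provides the wanted [S].  Otherwise a functional [F] with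
    [|F v| <= q v] has real part at least [e] at [(x_i)_i].  Its coordinates
    are functionals of norm at most one on [X], so that
    [weak_operator_approx] yields [S] with
    [e <= |F (S x_i)_i| + |F (x_i - S x_i)_i|
       <= theta (lambda C + eta) + m eta], which fails for small [eta]. *)
Lemma strong_operator_approx C m (x : 'I_m -> X) e mu :
  summing_const r T C -> 0 < e -> 0 < mu ->
  exists S : {linear X -> X},
    [/\ finite_rank_bounded S, summing_const r (T \o S) (lambda * C + mu) &
        forall i, rnorm (S (x i) - x i) < e].
Proof.
move=> TC e0 mu0; have [C0 _] := TC.
have l0 : 0 <= lambda by exact: le_trans l1.
pose M := lambda * C + mu.
have M0 : 0 < M by rewrite ltr_wpDl// mulr_ge0.
have [theta theta0 thetaM] : exists2 theta, 0 < theta & theta * M = e.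
  by exists (e / M); [rewrite divr_gt0|rewrite divfK// gt_eqF].
pose xbar : {ffun 'I_m -> X} := [ffun i => x i].
have [xe|ex] := ltP (gauge x theta xbar) e.
  have [t [S [N [Sfr SN tS]]] te] := gauge_lt (ltW theta0) xe.
  have [N0 _] := SN.
  have Se : \sum_i rnorm (xbar i - S (x i)) + theta * N < e.
    exact: le_lt_trans te.
  have sum0 : 0 <= \sum_i rnorm (xbar i - S (x i)).
    by apply: sumr_ge0 => i _; exact: rnorm_ge0.
  exists S; split; first exact: Sfr.
    apply: (summing_const_le r1 _ SN).
    rewrite -(ler_pM2l theta0) -/M thetaM.
    by apply: ltW; apply: le_lt_trans Se; rewrite lerDr.
  move=> i; rewrite rnormB; apply: le_lt_trans Se.
  rewrite (bigD1 i)//= ffunE -addrA lerDl addr_ge0 ?mulr_ge0 ?(ltW theta0)//.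
  by apply: sumr_ge0 => j _; exact: rnorm_ge0.
exfalso.
have [F [Fq Fx]] := hahn_banach
  (gaugeD x (ltW theta0)) (gaugeZ x (ltW theta0)) xbar.
pose iota j (y : X) : {ffun 'I_m -> X} := [ffun i => if i == j then y else 0].
have /choice[f fE] : forall j, exists f : {linear X -> K^o},
    forall y, f y = F (iota j y).
  move=> j; apply: (@linear_map_exists K X K^o) => a y z.
  have -> : iota j (a *: y + z) = a *: iota j y + iota j z.
    apply/ffunP => i; rewrite !ffunE; case: ifP => // _.
    by rewrite scaler0 addr0.
  by rewrite linearP.
have f1 j y : modulus (f j y) <= rnorm y.
  rewrite fE (le_trans (Fq _))//.
  apply: (le_trans (gauge_le (ltW theta0) (gauge_set_norm _ _ _))).
  rewrite (bigD1 j)//= ffunE eqxx big1 ?addr0// => i ij.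
  by rewrite ffunE (negbTE ij) rnorm0.
have Fsum (v : {ffun 'I_m -> X}) : F v = \sum_j f j (v j).
  rewrite (eq_bigr (fun j => F (iota j (v j)))); last by move=> j _; exact: fE.
  rewrite -linear_sum; congr (F _); apply/ffunP => i.
  rewrite sum_ffunE (bigD1 i)//= ffunE eqxx big1 ?addr0// => j ji.
  by rewrite ffunE eq_sym (negbTE ji).
(* The inequality to be violated reads e (mu - eta) <= m eta M, that is
   e mu <= eta (e + m M); eta makes the right-hand side half of the left. *)
pose eta := e * mu / (2 * (e + m%:R * M)).
have D0 : 0 < e + m%:R * M by rewrite ltr_wpDr// mulr_ge0// ltW.
have eta0 : 0 < eta by rewrite divr_gt0 ?mulr_gt0.
have [S [Sfr SC Sx]] := weak_operator_approx r1 l1 LB x f1 TC eta0.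
pose Sbar : {ffun 'I_m -> X} := [ffun i => S (x i)].
have FS : modulus (F Sbar) <= theta * (lambda * C + eta).
  apply: (le_trans (Fq _)); apply: (gauge_le (ltW theta0)).
  exists S, (lambda * C + eta); split => //.
  rewrite big1 ?add0r// => i _.
  by rewrite ffunE subrr rnorm0.
have FxS : modulus (F (xbar - Sbar)) <= m%:R * eta.
  rewrite Fsum (le_trans (@rnorm_sum _ _ K^o _ _))//.
  apply: (@le_trans _ _ (\sum_(j < m) eta)); last first.
    by rewrite sumr_const card_ord mulr_natl.
  apply: ler_sum => j _; rewrite !ffunE -opprB linearN rnormN.
  exact: ltW (Sx j).
have key : e <= theta * (lambda * C + eta) + m%:R * eta.
  apply: (le_trans ex); rewrite -Fx.
  rewrite -(subrK Sbar xbar) linearD scalar_reD addrC.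
  by rewrite lerD// (le_trans (scalar_re_modulus _)).
have : e * M <= e * (lambda * C + eta) + m%:R * eta * M.
  have -> : e * (lambda * C + eta) = theta * (lambda * C + eta) * M.
    by rewrite mulrAC thetaM.
  by rewrite -mulrDl ler_pM2r.
have : eta * (e + m%:R * M) = e * mu / 2.
  by rewrite /eta; field; rewrite gt_eqF.
have emu : 0 < e * mu by rewrite mulr_gt0.
rewrite /M; nra.
Qed.

End Separation.

(** * The equivalence of the two properties *)

Section Equivalence.
Context {R : realType} {k : scalar_kind}.
Local Notation K := (scalar_field R k).
Variables (lambda : R) (l1 : 1 <= lambda).
Variable (X : completeNormedModType K).

Lemma in_class_continuous (p : \bar R) (Y : completeNormedModType K)
    (T : {linear X -> Y}) : in_class (P_class k p) T -> continuous T.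
Proof. by case: p => [r [] | |]. Qed.

Lemma weak_BAP_local (p : \bar R) :
  weak_BAP (P_class k p) lambda X -> local_BAP (P_class k p) lambda X.
Proof.
move=> WB Y T Tp; have Tc := in_class_continuous Tp.
have [I [le [S [ledir Sfr SX Slim]]]] := WB Y T Tp.
exists I, le, (fun a => T \o S a); split; [exact: ledir| | |exact: Slim].
  by move=> a; apply: finite_rank_bounded_comp.
by move=> x; apply: cvg_comp (SX x) (Tc x).
Qed.

Lemma op_norm_attained (Y : normedModType K) (T : {linear X -> Y}) :
  continuous T -> exists C, [/\ 0 <= C, op_norm T = C%:E &
    forall x, rnorm (T x) <= C * rnorm x].
Proof.
move=> /bounded_linearP[D [D0 /(op_norm_leP _ D0) TD]].
have n0 : (0 <= op_norm T)%E.
  apply: ereal_sup_ubound; exists 0; last by rewrite linear0 rnorm0.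
  by rewrite /= rnorm0.
have fn : op_norm T \is a fin_num.
  by rewrite ge0_fin_numE//; exact: le_lt_trans TD (ltry _).
exists (fine (op_norm T)); rewrite fineK//; split => //.
  exact: fine_ge0.
by apply/op_norm_leP; [exact: fine_ge0|rewrite fineK].
Qed.

(** The local property is applied to the identity of [X], which is not
    available for finite [p]: the identity is then not summing in general. *)
Lemma local_BAP_weak_bounded :
  local_BAP (P_class k +oo%E) lambda X -> weak_BAP (P_class k +oo%E) lambda X.
Proof.
move=> LB Y T /op_norm_attained[C [C0 TC Tb]].
have l0 : 0 <= lambda by exact: le_trans l1.
have [|I [le [S [ledir Sfr SX Slim]]]] := LB X idfun.
  by move=> x; exact: cvg_id.
exists I, le, S; split; [exact: ledir|exact: Sfr|exact: SX|].
rewrite /= TC; apply/lee_addgt0Pr => e e0.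
have C1 : 0 < C + 1 by rewrite ltr_wpDl.
have /net_limsup_lt[a Ha] :
    (net_limsup le (fun a => op_norm (S a)) <
     (lambda + e / (C + 1))%:E)%E.
  apply: (le_lt_trans Slim); apply: (@le_lt_trans _ _ (lambda * 1)%:E).
    rewrite EFinM lee_wpmul2l ?lee_fin//.
    by apply/(op_norm_leP _ ler01) => x; rewrite mul1r.
  by rewrite mulr1 lte_fin ltrDl divr_gt0.
apply: (@net_limsup_le _ _ _ _ _ a) => b ab.
have s0 : 0 <= lambda + e / (C + 1) by rewrite addr_ge0// divr_ge0 ?ltW.
have /ltW/(op_norm_leP _ s0) Sb := Ha b ab.
rewrite -EFinM -EFinD; apply/op_norm_leP.
  by rewrite addr_ge0 ?mulr_ge0 ?(ltW e0).
move=> x; apply: (le_trans (Tb _)).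
apply: (@le_trans _ _ (C * ((lambda + e / (C + 1)) * rnorm x))).
  by rewrite ler_wpM2l.
rewrite mulrA ler_wpM2r ?rnorm_ge0// mulrDr mulrC lerD2l.
by rewrite mulrCA ler_piMr ?(ltW e0)// ler_pdivrMr// mul1r lerDl.
Qed.

Lemma local_BAP_weak_summing (r : R) : 1 <= r ->
  local_BAP (P_class k r%:E) lambda X -> weak_BAP (P_class k r%:E) lambda X.
Proof.
move=> r1 LB Y T [_ [D TD]].
have [C TC normT] := summing_norm_attained r1 TD.
pose I := (seq X * nat)%type.
pose le (a b : I) := {subset a.1 <= b.1} /\ (a.2 <= b.2)%N.
have inv0 n : 0 < n.+1%:R^-1 :> R by rewrite invr_gt0.
have inv_le m n : (m <= n)%N -> n.+1%:R^-1 <= m.+1%:R^-1 :> R.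
  by move=> mn; rewrite lef_pV2 ?posrE// ler_nat.
have /choice[S HS] : forall a : I, exists S : {linear X -> X},
    [/\ finite_rank_bounded S,
        summing_const r (T \o S) (lambda * C + a.2.+1%:R^-1) &
        forall x, x \in a.1 -> rnorm (S x - x) < a.2.+1%:R^-1].
  move=> a; pose x (i : 'I_(size a.1)) := tnth (in_tuple a.1) i.
  have [S [Sfr SC Sx]] :=
    strong_operator_approx r1 l1 LB x TC (inv0 a.2) (inv0 a.2).
  exists S; split; [exact: Sfr|exact: SC|move=> y ya].
  have /tnthP[i ->] : y \in in_tuple a.1 by [].
  exact: Sx.
exists I, le, S; split.
- split.
  + by constructor; exact: ([::], 0%N).
  + by move=> a; split.
  + move=> a b c [ab1 ab2] [bc1 bc2]; split; last exact: leq_trans bc2.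
    by move=> x /ab1/bc1.
  + move=> a b; exists (a.1 ++ b.1, maxn a.2 b.2).
    split; split => [x xa|]; rewrite /= ?mem_cat ?xa ?orbT//.
      exact: leq_maxl.
    exact: leq_maxr.
- by move=> a; have [] := HS a.
- move=> x; apply/cvg_netP => e e0.
  have [n ne] : exists n, n.+1%:R^-1 < e :> R.
    by exists (Num.truncn e^-1); rewrite invf_plt ?posrE// truncnS_gt.
  exists ([:: x], n) => b [xb nb]; have [_ _ Sx] := HS b.
  apply: (lt_trans (Sx x (xb x _))); first by rewrite inE.
  exact: le_lt_trans (inv_le _ _ nb) ne.
- rewrite /= normT -EFinM; apply/lee_addgt0Pr => e e0.
  have [n ne] : exists n, n.+1%:R^-1 < e :> R.
    by exists (Num.truncn e^-1); rewrite invf_plt ?posrE// truncnS_gt.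
  apply: (@net_limsup_le _ _ _ _ _ ([::], n)) => b [_ nb].
  have [_ SC _] := HS b; apply: (le_trans (summing_norm_le SC)).
  by rewrite -EFinD lee_fin lerD2l (le_trans (inv_le _ _ nb))// ltW.
Qed.

End Equivalence.

Theorem corollary2p14 (R : realType) (k : scalar_kind)
    (lambda : R) (hlambda : 1 <= lambda) (p : \bar R) (hp : (1%:E <= p)%E)
    (X : completeNormedModType (scalar_field R k)) :
  weak_BAP (P_class k p) lambda X <-> local_BAP (P_class k p) lambda X.
Proof.
split; first exact: weak_BAP_local.
case: p hp => [r|_|//]; last exact: local_BAP_weak_bounded.
by rewrite lee_fin => r1; exact: local_BAP_weak_summing.
Qed.
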